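(* Let $\Phi$ be the root system of rank $n$, with positive roots $\Phi^+$, of a simple algebraic group $G$ over $\mathbb{C}$ whose type is not one of $F_4, E_6, E_7, E_8$. Let $\mathcal{I} \subset \Phi^+$ be an ideal, with ideal exponents $m^{\mathcal{I}}_1, \dots, m^{\mathcal{I}}_k$. Then the hyperplane arrangement $\mathcal{A}_{\mathcal{I}}$ is free and its non-zero exponents are $m^{\mathcal{I}}_1, \dots, m^{\mathcal{I}}_k$. There are also $n-k$ exponents equal to $0$.
   Context: $G$ is a simple algebraic group over $\mathbb{C}$ with Borel subgroup $B$ and maximal torus $T \subset B$; $\Phi$ is the associated (irreducible) root system, $\Pi \subset \Phi^+$ are the simple and positive roots determined by $B$, and $Q^\vee$ is the coroot lattice. For $\beta = \sum_{\alpha\in\Pi} c_\alpha \alpha \in \Phi$, the height is $\mathrm{ht}(\beta) = \sum_{\alpha \in \Pi} c_\alpha$. An ideal $\mathcal{I}$ of $\Phi^+$ is a subset such that if $\alpha \in \mathcal{I}$, $\beta \in \Phi^+$ and $\alpha+\beta \in \Phi^+$, then $\alpha+\beta \in \mathcal{I}$. Write $\mathcal{I}^c = \Phi^+ - \mathcal{I}$. Ideal exponents: let $\lambda_i = \#\{\alpha \in \mathcal{I}^c \mid \mathrm{ht}(\alpha) = i\}$ for $i\ge 1$. Then $\lambda_1 \ge \lambda_2 \ge \cdots$. Put $k = \lambda_1$ (the number of simple roots in $\mathcal{I}^c$). The ideal exponents $m^{\mathcal{I}}_k \ge \dots \ge m^{\mathcal{I}}_1$ are the parts of the dual partition of $(\lambda_i)$,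 i.e. $m^{\mathcal{I}}_i = \#\{ j \mid \lambda_j \ge k-i+1\}$. Arrangement: let $V = Q^\vee \otimes \mathbb{R}$ and, for $\alpha \in \Phi^+$, $H_\alpha = \{v \in V \mid \langle \alpha, v\rangle = 0\}$. Then $\mathcal{A}_{\mathcal{I}} = \{H_\alpha \mid \alpha \in \mathcal{I}^c\}$, an arrangement in $V$. Freeness: for a (central) arrangement $\mathcal{A}$ in a real vector space $V$, let $S(V^* )$ be the symmetric algebra of $V^*$, for $H \in \mathcal{A}$ let $\alpha_H \in V^*$ be a linear form with kernel $H$, and $Q(\mathcal{A}) = \prod_{H \in \mathcal{A}} \alpha_H$. Let $D(\mathcal{A})$ be the module of $\mathbb{R}$-linear derivations of $S(V^* )$ which preserve the ideal generated by $Q(\mathcal{A})$. $\mathcal{A}$ is free if $D(\mathcal{A})$ is a free $S(V^* )$-module; its exponents are then the polynomial degrees (with multiplicity) of a homogeneous basis of $D(\mathcal{A})$, where a homogeneous derivation has polynomial degree $d$ if it maps $V^*$ into the degree-$d$ part of $S(V^* )$. (By Terao, these coincide with the roots, with multiplicity, of the characteristic polynomial of $\mathcal{A}$.) *)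

(* Defs.v *)
From HB Require Import structures.
From mathcomp Require Import all_boot all_order all_algebra.
From mathcomp Require Import perm finmap mpoly.
From mathcomp Require Import boolp classical_sets reals.

Set Implicit Arguments.
Unset Strict Implicit.
Unset Printing Implicit Defensive.

Import Order.TTheory GRing.Theory Num.Theory.

Local Open Scope fset_scope.
Local Open Scope ring_scope.

(* V = Q^v (x) R is the space of columns 'cV[R]_n, and its dual V^* (where     *)
(* the roots live) is the space of rows 'rV[R]_n, in dual bases.              *)
Definition pairing (R : realType) (n : nat) (a : 'rV[R]_n) (v : 'cV[R]_n) : R :=
  (a *m v) 0 0.

(* The values of [coroot] outside of [roots] are irrelevant. *)
Record root_system (R : realType) (n : nat) := RootSystem {
  roots :> {fset 'rV[R]_n};
  coroot : 'rV[R]_n -> 'cV[R]_n;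
  root_neq0 : 0 \notin roots;
  roots_span : <<roots>>%VS = fullv;
  pairing_coroot : forall a, a \in roots -> pairing a (coroot a) = 2;
  pairing_int : forall a b, a \in roots -> b \in roots ->
    pairing b (coroot a) \is a Num.int;
  reflection_root : forall a b, a \in roots -> b \in roots ->
    b - pairing b (coroot a) *: a \in roots;
  roots_reduced : forall (a : 'rV[R]_n) (c : R),
    a \in roots -> c *: a \in roots -> c = 1 \/ c = -1
}.

Section RootCombinatorics.

Variables (R : realType) (n : nat).
Implicit Types (Phi : root_system R n) (D : n.-tuple 'rV[R]_n).
Implicit Types (I J : {fset 'rV[R]_n}) (a b : 'rV[R]_n).

Definition irreducible_roots Phi : Prop :=
  roots Phi <> fset0 /\
  forall A : {fset 'rV[R]_n}, A `<=` roots Phi ->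
    (forall a b, a \in A -> b \in roots Phi `\` A ->
       pairing a (coroot Phi b) = 0) ->
    A = fset0 \/ A = roots Phi.

(* D lists the simple roots in an arbitrary order. *)
Definition is_base Phi D : Prop :=
  [/\ basis_of fullv D,
      {subset D <= roots Phi}
    & forall b, b \in roots Phi ->
        (forall i, coord D i b \is a Num.nat) \/
        (forall i, - coord D i b \is a Num.nat)].

Definition pos_roots Phi D : {fset 'rV[R]_n} :=
  [fset b in roots Phi | [forall i, 0 <= coord D i b]].

Definition height D b : R := \sum_(i < n) coord D i b.

(* C i j = <alpha_i, alpha_j^v> for some numbering alpha_0, ..., alpha_(r-1)   *)
(* of the simple roots.                                                       *)
Definition has_cartan_matrix Phi D (r : nat) (C : nat -> nat -> int) : Prop :=
  n = r /\ exists s : 'S_n, forall i j : 'I_n,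
    pairing (tnth D (s i)) (coroot Phi (tnth D (s j))) = (C i j)%:~R.

Definition is_ideal Phi D I : Prop :=
  I `<=` pos_roots Phi D /\
  forall a b, a \in I -> b \in pos_roots Phi D ->
    a + b \in pos_roots Phi D -> a + b \in I.

(* In the next three definitions J stands for the complement of an ideal in   *)
(* the set of positive roots.                                                 *)
Definition lambda D J (i : nat) : nat := #|` [fset a in J | height D a == i%:R]|.

Definition max_height D J : nat := \max_(a <- J) Num.truncn (height D a).

(* lambda D J j vanishes for j > max_height D J, while k - i + 1 > 0, so the  *)
(* count over all j >= 1 reduces to 1 <= j <= max_height D J.                 *)
Definition ideal_exponent D J (i : nat) : nat :=
  let k := lambda D J 1 in
  count (fun j => (k - i + 1 <= lambda D J j)%N) (iota 1 (max_height D J)).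

End RootCombinatorics.

(* Exceptional Cartan matrices, in Bourbaki's numbering shifted to start at 0. *)

Definition cartan_F4 (i j : nat) : int :=
  nth 0 (nth [::] [:: [::  2; -1;  0;  0];
                      [:: -1;  2; -2;  0];
                      [::  0; -1;  2; -1];
                      [::  0;  0; -1;  2]] i) j.

(* E_6, E_7 and E_8 use the first 6, 7 and 8 rows and columns. *)
Definition edges_E : seq (nat * nat) :=
  [:: (0, 2); (1, 3); (2, 3); (3, 4); (4, 5); (5, 6); (6, 7)]%N.

Definition cartan_E (i j : nat) : int :=
  if i == j then 2
  else if ((i, j) \in edges_E) || ((j, i) \in edges_E) then -1 else 0.

Section Arrangements.

Variables (R : realType) (n : nat).

Definition hyperplane (a : 'rV[R]_n) : {vspace 'cV[R]_n} :=
  lker (linfun (mulmx a : 'cV[R]_n -> 'M[R]_1)).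

Definition root_arrangement (J : {fset 'rV[R]_n}) : {fset {vspace 'cV[R]_n}} :=
  [fset hyperplane a | a in J].

(* {mpoly R[n]} is the symmetric algebra of the dual of V, with 'X_i the i-th *)
(* coordinate form on V.                                                      *)
Definition linear_form (a : 'rV[R]_n) : {mpoly R[n]} :=
  \sum_(i < n) a 0 i *: 'X_i.

(* A choice of alpha_H, determined up to a nonzero scalar. *)
Definition form_of (H : {vspace 'cV[R]_n}) : 'rV[R]_n :=
  xget 0 [set a | hyperplane a = H]%classic.

Definition defining_poly (A : {fset {vspace 'cV[R]_n}}) : {mpoly R[n]} :=
  \prod_(H <- A) linear_form (form_of H).

Definition is_derivation (theta : {mpoly R[n]} -> {mpoly R[n]}) : Prop :=
  linear theta /\
  forall f g, theta (f * g) = theta f * g + f * theta g.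

Definition in_principal_ideal (q f : {mpoly R[n]}) : Prop :=
  exists g, f = g * q.

Definition in_derivation_module (A : {fset {vspace 'cV[R]_n}})
    (theta : {mpoly R[n]} -> {mpoly R[n]}) : Prop :=
  is_derivation theta /\
  forall f, in_principal_ideal (defining_poly A) f ->
    in_principal_ideal (defining_poly A) (theta f).

Definition is_derivation_basis (A : {fset {vspace 'cV[R]_n}}) (m : nat)
    (b : 'I_m -> {mpoly R[n]} -> {mpoly R[n]}) : Prop :=
  [/\ forall i, in_derivation_module A (b i),
      forall theta, in_derivation_module A theta ->
        exists p : 'I_m -> {mpoly R[n]},
          forall f, theta f = \sum_(i < m) p i * b i f
    & forall p : 'I_m -> {mpoly R[n]},
        (forall f, \sum_(i < m) p i * b i f = 0) -> forall i, p i = 0].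

Definition is_free (A : {fset {vspace 'cV[R]_n}}) : Prop :=
  exists (m : nat) (b : 'I_m -> {mpoly R[n]} -> {mpoly R[n]}),
    is_derivation_basis A b.

Definition has_poly_degree (theta : {mpoly R[n]} -> {mpoly R[n]}) (d : nat) :
    Prop :=
  forall a : 'rV[R]_n, theta (linear_form a) \is d.-homog.

Definition has_exponents (A : {fset {vspace 'cV[R]_n}}) (e : seq nat) : Prop :=
  exists b : 'I_(size e) -> {mpoly R[n]} -> {mpoly R[n]},
    is_derivation_basis A b /\
    forall i : 'I_(size e), has_poly_degree (b i) (nth 0%N e i).

End Arrangements.

(* Main.v *)
Require Import Defs.
From HB Require Import structures.
From mathcomp Require Import all_boot all_order all_algebra.
From mathcomp Require Import finmap mpoly.
From mathcomp Require Import boolp classical_sets reals.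
From mathcomp Require Import ring lra zify.

Set Implicit Arguments.
Unset Strict Implicit.
Unset Printing Implicit Defensive.

Import Order.TTheory GRing.Theory Num.Theory.

Local Open Scope fset_scope.
Local Open Scope ring_scope.

(** Roots are added height by height.  Let [J] be the complement of the ideal
    and suppose that the derivations tangent to the roots of [J] of height at
    most [m] have a homogeneous basis whose degrees are at most [m].  Adding
    all roots of height [m + 1] at once raises by one the degree of as many
    basis elements of degree [m] as there are new roots, and leaves the other
    degrees alone ([multiple_addition]).  Starting from the empty arrangement, whose
    exponents are all 0, the number of exponents that are at least [t] ends up
    being the number of roots of height [t] in [J], which describes the dual
    partition.

    A step needs two facts about the new roots.  First, for a new root [b], the
    hyperplane of [b] meets the [N] old ones in exactly [N - m] different
    subspaces.  All values on [b] of old derivations are then divisible, modulo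
    [b], by a polynomial of degree [m] ([restriction_polynomial]), so that old
    basis elements of degree less than [m] are already tangent to [b].  The
    subspaces correspond to planes of roots through [b].  Since the sum of all
    positive coroots takes the value 2 on each indecomposable root
    ([pairing_rho]), twice the height of [b] is a sum of Cartan numbers, to
    which each plane contributes according to the height of [b] in the rank 2
    subsystem of that plane; such a subsystem is, apart from its two simple
    roots, a chain ([plane_chain]), so this local height counts the old roots
    in the plane ([restriction_count]).

    Second, the new hyperplanes must meet transversally, in a subspace that is
    not contained in an old hyperplane: this makes the matrix of leading
    coefficients of the basis elements of degree [m] of full rank.
    Transversality holds because differences of roots of the same height are
    not roots, so that the new roots are pairwise obtuse.  That no old root is
    a combination of the new ones is [level_gap]: roots that are equally high
    are as low as possible within the subsystem that they span. *)

(** * Linear forms and restriction to their kernels *)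

Section LinearForms.

Variables (R : realType) (n : nat).
Implicit Types (a b : 'rV[R]_n) (x : 'cV[R]_n) (f g q : {mpoly R[n]}).

Lemma linear_form_is_linear : linear (@linear_form R n).
Proof.
move=> k a b; rewrite /linear_form scaler_sumr -big_split /=.
by apply: eq_bigr => i _; rewrite !mxE scalerDl scalerA.
Qed.

HB.instance Definition _ :=
  GRing.isLinear.Build R 'rV[R]_n {mpoly R[n]} *:%R (@linear_form R n)
    linear_form_is_linear.

Lemma linear_form_coeff a i : (linear_form a)@_U_(i) = a 0 i.
Proof.
rewrite /linear_form raddf_sum (bigD1 i) //= mcoeffZ mcoeffX eqxx mulr1.
rewrite big1 ?addr0 // => j ji.
by rewrite mcoeffZ mcoeffXU (negbTE ji) mulr0.
Qed.

Lemma linear_form_eq0 a : (linear_form a == 0) = (a == 0).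
Proof.
apply/eqP/eqP => [a0|->]; last exact: linear0.
by apply/rowP => i; rewrite -linear_form_coeff a0 mcoeff0 mxE.
Qed.

Lemma linear_form_homog a : linear_form a \is 1.-homog.
Proof.
by apply: rpred_sum => i _; apply: rpredZ; rewrite dhomogX /= mdeg1.
Qed.

Lemma linear_form_delta i : linear_form (delta_mx 0 i) = 'X_i :> {mpoly R[n]}.
Proof.
rewrite /linear_form (bigD1 i) //= big1 => [|j ji].
  by rewrite mxE !eqxx scale1r addr0.
by rewrite mxE (negbTE ji) andbF scale0r.
Qed.

Definition point x : 'I_n -> R := fun i => x i 0.

Lemma meval_linear_form a x : (linear_form a).@[point x] = pairing a x.
Proof.
rewrite /linear_form /pairing raddf_sum mxE /=; apply: eq_bigr => i _.
by rewrite mevalZ mevalXU.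
Qed.

(** For nonzero [a], a vector on which [a] takes the value 1; it splits the
    space into the kernel of [a] and a line. *)
Definition dual_vec a : 'cV[R]_n := (pairing a a^T)^-1 *: a^T.

Lemma pairingDl a b x : pairing (a + b) x = pairing a x + pairing b x.
Proof. by rewrite /pairing mulmxDl mxE. Qed.
Lemma pairingZl k a x : pairing (k *: a) x = k * pairing a x.
Proof. by rewrite /pairing -scalemxAl mxE. Qed.
Lemma pairingDr a x y : pairing a (x + y) = pairing a x + pairing a y.
Proof. by rewrite /pairing mulmxDr mxE. Qed.
Lemma pairingZr k a x : pairing a (k *: x) = k * pairing a x.
Proof. by rewrite /pairing -scalemxAr mxE. Qed.
Lemma pairingNl a x : pairing (- a) x = - pairing a x.
Proof. by rewrite /pairing mulNmx mxE. Qed.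
Lemma pairingBl a b x : pairing (a - b) x = pairing a x - pairing b x.
Proof. by rewrite pairingDl pairingNl. Qed.
Lemma pairing0l x : pairing 0 x = 0.
Proof. by rewrite /pairing mul0mx mxE. Qed.
Lemma pairing0r a : pairing a 0 = 0.
Proof. by rewrite /pairing mulmx0 mxE. Qed.
Lemma pairing_suml (I : Type) (r : seq I) (P : pred I) (F : I -> 'rV[R]_n) x :
  pairing (\sum_(i <- r | P i) F i) x = \sum_(i <- r | P i) pairing (F i) x.
Proof. exact: (big_morph _ (fun a b => pairingDl a b x) (pairing0l x)). Qed.
Lemma pairing_sumr (I : Type) (r : seq I) (P : pred I) a (F : I -> 'cV[R]_n) :
  pairing a (\sum_(i <- r | P i) F i) = \sum_(i <- r | P i) pairing a (F i).
Proof. exact: (big_morph _ (pairingDr a) (pairing0r a)). Qed.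

Lemma sqr_row_gt0 a : a != 0 -> 0 < pairing a a^T.
Proof.
move=> a0; have sqE : pairing a a^T = \sum_i a 0 i ^+ 2.
  by rewrite /pairing mxE; apply: eq_bigr => i _; rewrite mxE.
rewrite sqE lt_def sumr_ge0 ?andbT; last by move=> i _; exact: sqr_ge0.
apply: contra a0 => /eqP s0; apply/eqP/rowP => i; rewrite mxE.
have /psumr_eq0P h : forall i, true -> 0 <= a 0 i ^+ 2 by move=> *; exact: sqr_ge0.
by apply/eqP; rewrite -(sqrf_eq0 (a 0 i)); apply/eqP; exact: h.
Qed.

Lemma pairing_dual_vec a : a != 0 -> pairing a (dual_vec a) = 1.
Proof. by move=> a0; rewrite pairingZr mulVf // gt_eqF ?sqr_row_gt0. Qed.

(** Restriction to the kernel of [a], realised inside the polynomial ring by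
    pulling back along the projection of the space onto that kernel. *)
Definition restrict_form a b := b - pairing b (dual_vec a) *: a.

Definition restrict a : {mpoly R[n]} -> {mpoly R[n]} :=
  comp_mpoly [tuple linear_form (restrict_form a (delta_mx 0 i)) | i < n].

HB.instance Definition _ a := GRing.LRMorphism.copy (restrict a)
  (comp_mpoly [tuple linear_form (restrict_form a (delta_mx 0 i)) | i < n]).

Lemma restrict_form_is_linear a : linear (restrict_form a).
Proof.
move=> k b c; rewrite /restrict_form pairingDl pairingZl scalerBr scalerDl.
by rewrite scalerA opprD addrACA.
Qed.

HB.instance Definition _ a :=
  GRing.isLinear.Build R 'rV[R]_n 'rV[R]_n *:%R (restrict_form a)
    (restrict_form_is_linear a).

Lemma restrict_form_self a : restrict_form a a = 0.
Proof.
have [->|a0] := eqVneq a 0; first by rewrite /restrict_form scaler0 subr0.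
by rewrite /restrict_form pairing_dual_vec // scale1r subrr.
Qed.

Lemma restrictX a i :
  restrict a 'X_i = linear_form (restrict_form a (delta_mx 0 i)).
Proof. by rewrite /restrict comp_mpolyXU -tnth_nth tnth_mktuple. Qed.

Lemma restrict_linear_form a b :
  restrict a (linear_form b) = linear_form (restrict_form a b).
Proof.
rewrite {1}/linear_form linear_sum /= [in RHS](row_sum_delta b) !linear_sum /=.
by apply: eq_bigr => i _; rewrite !linearZ /= restrictX.
Qed.

Local Notation mdvd := (@in_principal_ideal R n).

Lemma mdvd0 q : mdvd q 0. Proof. by exists 0; rewrite mul0r. Qed.
Lemma mdvdD q f g : mdvd q f -> mdvd q g -> mdvd q (f + g).
Proof. by move=> [u ->] [v ->]; exists (u + v); rewrite mulrDl. Qed.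
Lemma mdvdM q f g : mdvd q f -> mdvd q (g * f).
Proof. by move=> [u ->]; exists (g * u); rewrite mulrA. Qed.
Lemma mdvdMr q f g : mdvd q f -> mdvd q (f * g).
Proof. by rewrite mulrC; exact: mdvdM. Qed.
Lemma mdvdN q f : mdvd q f -> mdvd q (- f).
Proof. by move=> [u ->]; exists (- u); rewrite mulNr. Qed.
Lemma mdvdB q f g : mdvd q f -> mdvd q g -> mdvd q (f - g).
Proof. by move=> qf /mdvdN; exact: mdvdD. Qed.
Lemma mdvdZ q k f : mdvd q f -> mdvd q (k *: f).
Proof. by move=> [u ->]; exists (k *: u); rewrite scalerAl. Qed.
Lemma mdvd_refl q : mdvd q q. Proof. by exists 1; rewrite mul1r. Qed.
Lemma mdvd_trans q f g : mdvd q f -> mdvd f g -> mdvd q g.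
Proof. by move=> qf [u ->]; exact: mdvdM. Qed.
Lemma mdvd_sum q (I : Type) (r : seq I) (P : pred I) (F : I -> {mpoly R[n]}) :
  (forall i, P i -> mdvd q (F i)) -> mdvd q (\sum_(i <- r | P i) F i).
Proof. by move=> h; apply: big_ind => //; [exact: mdvd0|exact: mdvdD]. Qed.

(** Linear forms congruent modulo [a] restrict equally, and this extends
    multiplicatively from the variables to all polynomials. *)
Lemma restrict_congr a f : mdvd (linear_form a) (f - restrict a f).
Proof.
pose E g := mdvd (linear_form a) (g - restrict a g).
have EM g h : E g -> E h -> E (g * h).
  move=> Eg Eh; rewrite /E rmorphM.
  have -> : g * h - restrict a g * restrict a h =
    h * (g - restrict a g) + restrict a g * (h - restrict a h) by ring.
  by apply: mdvdD; exact: mdvdM.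
have E1 : E 1 by rewrite /E rmorph1 subrr; exact: mdvd0.
have EX i : E 'X_i.
  rewrite /E restrictX raddfB /= linearZ /= linear_form_delta opprB addrC subrK.
  exact/mdvdZ/mdvd_refl.
have EXm m : E 'X_[m].
  rewrite mpolyXE_id; apply: big_ind => // i _.
  by elim: (m i) => [|k IH]; rewrite ?expr0 // exprS; exact: EM.
rewrite -/(E f) [f]mpolyE; apply: big_ind => [|g h Eg Eh|m _].
- by rewrite /E raddf0 subrr; exact: mdvd0.
- by rewrite /E raddfD opprD addrACA; exact: mdvdD.
by rewrite /E linearZ /= -scalerBr; apply: mdvdZ; exact: EXm.
Qed.

Lemma restrict_linear_form_self a : restrict a (linear_form a) = 0.
Proof. by rewrite restrict_linear_form restrict_form_self linear0. Qed.

Lemma restrict_mdvd a f : mdvd (linear_form a) f <-> restrict a f = 0.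
Proof.
split=> [[g ->]|r0]; first by rewrite rmorphM /= restrict_linear_form_self mulr0.
by have := restrict_congr a f; rewrite r0 subr0.
Qed.

Lemma meval_restrict a x f :
  pairing a x = 0 -> (restrict a f).@[point x] = f.@[point x].
Proof.
move=> ax; have [g fE] := restrict_congr a f.
apply/esym/eqP; rewrite -subr_eq0 -mevalB fE mevalM meval_linear_form ax.
by rewrite mulr0.
Qed.

Lemma restrict_homog a d f : f \is d.-homog -> restrict a f \is d.-homog.
Proof.
move=> /dhomogP hf; rewrite [f]mpolyE raddf_sum /=.
rewrite big_seq; apply: rpred_sum => m /hf <-; rewrite linearZ /=; apply: rpredZ.
rewrite /restrict comp_mpolyX mdegE.
apply: (big_ind2 (fun (g : {mpoly R[n]}) e => g \is e.-homog)) =>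
  [|g1 e1 g2 e2|i _].
- exact: dhomog1.
- exact: dhomogM.
by rewrite tnth_mktuple -[X in X.-homog]mul1n; apply/dhomogMn/linear_form_homog.
Qed.

(** The quotient by the ideal of [a] is realised by [restrict a] inside the
    integral domain of polynomials, so this ideal is prime. *)
Lemma linear_form_prime a f g :
  mdvd (linear_form a) (f * g) -> mdvd (linear_form a) f \/ mdvd (linear_form a) g.
Proof.
move/restrict_mdvd; rewrite rmorphM /= => /eqP.
by rewrite mulf_eq0 => /orP[] /eqP /restrict_mdvd; [left|right].
Qed.

Lemma linear_form_prime_prod a (I : eqType) (r : seq I) (F : I -> {mpoly R[n]}) :
  mdvd (linear_form a) (\prod_(i <- r) F i) ->
  exists2 i, i \in r & mdvd (linear_form a) (F i).
Proof.
elim: r => [|i r IH].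
  by rewrite big_nil => /restrict_mdvd/eqP; rewrite rmorph1 oner_eq0.
rewrite big_cons => /linear_form_prime[ai|/IH[j jr aj]].
  by exists i; rewrite ?mem_head.
by exists j; rewrite // inE jr orbT.
Qed.

Lemma linear_form_mdvd a b :
  a != 0 -> mdvd (linear_form a) (linear_form b) -> exists k, b = k *: a.
Proof.
move=> a0 /restrict_mdvd; rewrite restrict_linear_form => /eqP.
by rewrite linear_form_eq0 subr_eq0 => /eqP ->; eexists.
Qed.

(** Since linear forms are prime, a power of the form of [F i] dividing the
    product of its cofactor with powers of non-proportional forms already
    divides the cofactor. *)
Lemma mdvd_prod_linear_forms (I : eqType) (r : seq I) (F : I -> 'rV[R]_n)
    (k : I -> nat) f :
  uniq r -> {in r, forall i, F i != 0} ->
  {in r &, forall i j (c : R), F i = c *: F j -> i = j} ->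
  {in r, forall i, mdvd (linear_form (F i) ^+ k i) f} ->
  mdvd (\prod_(i <- r) linear_form (F i) ^+ k i) f.
Proof.
elim: r => [|i r IH] /=.
  by move=> *; rewrite big_nil; exists f; rewrite mulr1.
move=> /andP[ir ur] F0 Finj Fdvd; rewrite big_cons.
have [|||g fE] := IH ur.
- by move=> j jr; apply: F0; rewrite inE jr orbT.
- by move=> j1 j2 j1r j2r; apply: Finj; rewrite inE ?j1r ?j2r orbT.
- by move=> j jr; apply: Fdvd; rewrite inE jr orbT.
have i0 : linear_form (F i) != 0 by rewrite linear_form_eq0 F0 ?mem_head.
have /Fdvd : i \in i :: r by exact: mem_head.
suff key e h : mdvd (linear_form (F i) ^+ e)
    (h * \prod_(j <- r) linear_form (F j) ^+ k j) ->
    mdvd (linear_form (F i) ^+ e) h.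
  by rewrite fE => /key [u ->]; exists u; rewrite mulrA.
elim: e h => [|e IHe] h; first by exists h; rewrite expr0 mulr1.
rewrite exprS => - [u hE].
have [||[v hv]] := @linear_form_prime (F i) h
    (\prod_(j <- r) linear_form (F j) ^+ k j).
- by rewrite hE; exists (u * linear_form (F i) ^+ e); ring.
- move=> [v hv]; rewrite hv.
  have [|w ->] := IHe v; last by exists w; ring.
  by exists u; apply: (mulfI i0); rewrite [RHS]mulrCA -hE hv; ring.
have Pv : mdvd (linear_form (F i)) (\prod_(j <- r) linear_form (F j) ^+ k j).
  by exists v.
have [j jr] := linear_form_prime_prod Pv.
have prime_exp l : mdvd (linear_form (F i)) (linear_form (F j) ^+ l) ->
    mdvd (linear_form (F i)) (linear_form (F j)).
  elim: l => [|l IHl].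
    by move=> /restrict_mdvd/eqP; rewrite rmorph1 oner_eq0.
  by rewrite exprS => /linear_form_prime[|/IHl].
move=> /prime_exp.
move=> /linear_form_mdvd [|c jE]; first by rewrite F0 ?mem_head.
have ji : j = i by apply: (Finj _ _ _ _ c); rewrite ?mem_head // inE jr orbT.
by rewrite -ji jr in ir.
Qed.

End LinearForms.

(** * Logarithmic derivations and the multiple addition theorem *)

Section LogarithmicDerivations.

Variables (R : realType) (n : nat).
Implicit Types (a : 'rV[R]_n) (J : {fset 'rV[R]_n}).
Implicit Types (p : 'rV[{mpoly R[n]}]_n) (M : 'M[{mpoly R[n]}]_n).
Local Notation mdvd := (@in_principal_ideal R n).

(** A derivation is encoded by the row [p] of its values on the variables;
    [act p a] is then its value on the form [a]. *)
Definition act p a : {mpoly R[n]} := \sum_j a 0 j *: p 0 j.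

Lemma actDl p p' a : act (p + p') a = act p a + act p' a.
Proof.
by rewrite -big_split; apply: eq_bigr => j _; rewrite mxE scalerDr.
Qed.

Lemma actZl g p a : act (g *: p) a = g * act p a.
Proof.
by rewrite /act mulr_sumr; apply: eq_bigr => j _; rewrite mxE scalerAr.
Qed.

Lemma act0l a : act 0 a = 0.
Proof. by rewrite /act big1 // => j _; rewrite mxE scaler0. Qed.

Lemma act_suml (I : Type) (r : seq I) (P : pred I) F a :
  act (\sum_(i <- r | P i) F i) a = \sum_(i <- r | P i) act (F i) a.
Proof. exact: (big_morph _ (fun p p' => actDl p p' a) (act0l a)). Qed.

Lemma act_is_linear p : linear (act p).
Proof.
move=> k a b; rewrite /act scaler_sumr -big_split; apply: eq_bigr => j _ /=.
by rewrite !mxE scalerDl scalerA.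
Qed.

HB.instance Definition _ p :=
  GRing.isLinear.Build R 'rV[R]_n {mpoly R[n]} *:%R (act p) (act_is_linear p).

Lemma act_mulmx k (c : 'rV_k) (M : 'M[{mpoly R[n]}]_(k, n)) a :
  act (c *m M) a = \sum_i c 0 i * act (row i M) a.
Proof.
by rewrite mulmx_sum_row act_suml; apply: eq_bigr => i _; rewrite actZl.
Qed.

Definition log_derivation J p : Prop :=
  forall a, a \in J -> mdvd (linear_form a) (act p a).

Definition graded_basis J M (e : 'I_n -> nat) : Prop :=
  [/\ forall i, log_derivation J (row i M),
      forall p, log_derivation J p -> exists c, p = c *m M
    & forall i j, M i j \is (e i).-homog].

Lemma log_derivation_prod J p :
  log_derivation J (\prod_(a <- J) linear_form a *: p).
Proof.
move=> a aJ; rewrite actZl; apply: mdvdMr.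
rewrite (big_rem _ aJ) /=; exact/mdvdMr/mdvd_refl.
Qed.

(** The matrix [M] is invertible wherever the forms of [J] do not vanish: the
    product of these forms times any constant derivation is logarithmic. *)
Lemma graded_basis_unit J M e :
  graded_basis J M e ->
  exists P : 'M_n, P *m M = (\prod_(a <- J) linear_form a)%:M.
Proof.
case=> _ Mspan _.
have /choice[c cE] i := Mspan _ (@log_derivation_prod J (delta_mx 0 i)).
exists (\matrix_i c i); apply/row_matrixP => i.
by rewrite row_mul rowK -cE [RHS]rowE mul_mx_scalar.
Qed.

Lemma graded_basis0 :
  graded_basis fset0 1%:M (fun=> 0%N).
Proof.
split=> [i a|p _|i j]; first by rewrite inE.
  by exists p; rewrite mulmx1.
by rewrite mxE; case: eqP => _; rewrite ?dhomog1 ?dhomog0.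
Qed.

(** For degree reasons a quotient [g] of two forms is constant unless the
    dividend has the larger degree, and zero if it has the smaller one. *)
Lemma homog_quotient (g b : {mpoly R[n]}) d e :
  (e <= d)%N -> b != 0 -> b \is d.-homog -> g * b \is e.-homog ->
  exists2 c, g = c%:MP & e != d -> c = 0.
Proof.
move=> ed b0 hb hgb; have [->|g0] := eqVneq g 0; first by exists 0.
have gb0 : g * b != 0 by rewrite mulf_neq0.
have deg (f : {mpoly R[n]}) k : f != 0 -> f \is k.-homog -> msize f = k.+1.
  move=> f0 hf; have fk := dhomog_uniq f0 (dhomog_msize hf) hf.
  by rewrite -fk prednK // lt0n mmeasure_poly_eq0.
have := msizeM g0 b0; rewrite (deg _ _ gb0 hgb) (deg _ _ b0 hb) addnS /= => eE.
have g_gt0 : (0 < msize g)%N by rewrite lt0n mmeasure_poly_eq0.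
have [g1 ->] : msize g = 1%N /\ e = d.
  by move: eE g_gt0 ed; move: (msize g) => k; lia.
by have [c c0 ->] := msize_poly1P _ (introT eqP g1); exists c; rewrite ?eqxx.
Qed.


(** Each new form [a = row j B] comes with a
    polynomial [b j] of degree [d] through which all values [act p a] factor
    modulo [a].  Basis elements of degree less than [d] therefore preserve the
    new hyperplanes already, and those of degree [d] have values given by a
    constant matrix.  At a generic point [x] of the intersection of the new
    hyperplanes the old basis spans all tangent directions, so this matrix has
    rank [q]: constant row operations bring it to the shape where [q] basis
    elements are dual to the new forms, and all others are tangent to them.
    It then suffices to multiply those [q] elements by the respective forms. *)
Theorem multiple_addition J M e d q (B : 'M[R]_(q, n))
    (b : 'I_q -> {mpoly R[n]}) (x : 'cV[R]_n) :
  graded_basis J M e -> (forall i, e i <= d)%N -> row_free B ->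
  (forall j, b j != 0) -> (forall j, b j \is d.-homog) ->
  (forall j p, log_derivation J p ->
     mdvd (b j) (restrict (row j B) (act p (row j B)))) ->
  (forall j, pairing (row j B) x = 0) ->
  (forall a, a \in J -> pairing a x != 0) ->
  exists M' (f : 'I_q -> 'I_n),
    [/\ injective f, forall j, e (f j) = d &
        graded_basis (J `|` [fset row j B | j : 'I_q]) M'
          (fun i => e i + (i \in codom f))%N].
Proof.
move=> Mb e_le Bfree b0 bhom bdvd Bx Jx; have [Mlog Mspan Mhom] := Mb.
pose T i j := restrict (row j B) (act (row i M) (row j B)).
have act_homog i a : act (row i M) a \is (e i).-homog.
  by apply: rpred_sum => j _; apply: rpredZ; rewrite mxE.
have [C TE C_eq0] : exists2 C : 'M[R]_(n, q),
    forall i j, T i j = C i j *: b j & forall i j, e i != d -> C i j = 0.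
  have /choice[c cP] (ij : 'I_n * 'I_q) : exists c,
      T ij.1 ij.2 = c *: b ij.2 /\ (e ij.1 != d -> c = 0).
    case: ij => i j /=; have [g gE] := bdvd j _ (Mlog i).
    have hom : g * b j \is (e i).-homog by rewrite -gE; exact: restrict_homog.
    have [c gc cd] := homog_quotient (e_le i) (b0 j) (bhom j) hom.
    by exists c; rewrite /T gE gc mul_mpolyC.
  exists (\matrix_(i, j) c (i, j)) => i j; rewrite mxE.
    by case: (cP (i, j)).
  by case: (cP (i, j)).
have Cfull : row_full C.
  have [P PM] := graded_basis_unit Mb; set Q := \prod_(a <- J) _ in PM.
  have Qx : Q.@[point x] != 0.
    rewrite /Q rmorph_prod /= prodf_seq_neq0; apply/allP => a aJ.
    by rewrite meval_linear_form Jx.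
  pose ev k (N : 'M[{mpoly R[n]}]_(n, k)) := map_mx (meval (point x)) N.
  have MB : ev _ M *m B^T = C *m diag_mx (\row_j (b j).@[point x]).
    apply/matrixP => i j; rewrite mul_mx_diag !mxE.
    rewrite -[RHS]mevalZ -TE (meval_restrict _ (Bx j)) raddf_sum /=.
    by apply: eq_bigr => l _; rewrite mevalZ !mxE mulrC.
  have : Q.@[point x] *: B^T = ev _ P *m C *m diag_mx (\row_j (b j).@[point x]).
    rewrite -mulmxA -MB mulmxA -map_mxM PM map_scalar_mx mul_scalar_mx.
    by [].
  move=> /(congr1 mxrank); rewrite mxrank_scale_nz // mxrank_tr.
  rewrite (eqP Bfree) => qE.
  rewrite /row_full eqn_leq rank_leq_col /= [leqLHS]qE.
  exact: leq_trans (mxrankM_maxl _ _) (mxrankM_maxr _ _).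
pose f := fullrankfun Cfull; pose W := invmx (rowsub f C).
have Wu : rowsub f C \in unitmx by exact: fullrowsub_unit.
pose F : 'M[R]_(n, q) := \matrix_(i, j) (i == f j)%:R.
have f_inj : injective f by exact: fullrankfun_inj.
have FTE k (A : 'M_(n, k)) : F^T *m A = rowsub f A.
  apply/matrixP => i j; rewrite !mxE (bigD1 (f i)) //= !mxE eqxx mul1r.
  by rewrite big1 ?addr0 // => l lf; rewrite !mxE (negbTE lf) mul0r.
have FTF : rowsub f F = 1%:M.
  by apply/matrixP => i j; rewrite !mxE (inj_eq f_inj).
(* the row operations [U] map [C] to the selection matrix [F] *)
pose U : 'M[R]_n := 1%:M - (C - F) *m W *m F^T.
pose V : 'M[R]_n := 1%:M + (C - F) *m F^T.
have VU : V *m U = 1%:M.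
  have FCFW : F^T *m (C - F) *m W = 1%:M - W.
    by rewrite mulmxBr !FTE FTF mulmxBl mul1mx mulmxV.
  rewrite /U /V; move: (C - F) FCFW => A FCFW.
  rewrite mulmxDl mul1mx mulmxBr mulmx1 (mulmxA _ (A *m W)) -(mulmxA A F^T).
  rewrite (mulmxA F^T) FCFW mulmxBr mulmx1 mulmxBl subKr.
  by rewrite subrK.
have UC : U *m C = F.
  by rewrite mulmxBl mul1mx -(mulmxA _ F^T C) FTE mulmxKV // subKr.
have ef j : e (f j) = d.
  apply: contraTeq Wu => efd; rewrite unitmxE (expand_det_row _ j).
  by rewrite big1 ?unitr0 // => l _; rewrite mxE C_eq0 ?mul0r.
(* only rows of degree [d] are mixed, so [U] preserves homogeneity *)
have Ue i k : U i k != 0 -> e i = e k.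
  have [-> //|ik] := eqVneq i k; rewrite !mxE (negbTE ik) sub0r oppr_eq0 => Uik.
  have [l] : exists l, ((C - F) *m W) i l * F^T l k != 0.
    apply/existsP; apply: contraNT Uik; rewrite negb_exists => /forallP h.
    by rewrite big1 // => l _; apply/eqP; rewrite -[_ == _]negbK.
  rewrite mulf_eq0 negb_or => /andP[CFl]; rewrite !mxE.
  case: (k =P f l) => [-> _|_]; last by rewrite eqxx.
  rewrite ef; have [//|eid] := eqVneq (e i) d.
  case/negP: CFl; rewrite mxE big1 // => j _.
  rewrite [(C - F) i j]mxE C_eq0 // !mxE; case: eqP => [iE|_].
    by rewrite iE ef eqxx in eid.
  by rewrite oppr0 addr0 mul0r.
pose N := map_mx (@mpolyC n R) U *m M.
have actN i a : act (row i N) a = \sum_k U i k *: act (row k M) a.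
  rewrite row_mul act_mulmx; apply: eq_bigr => k _.
  by rewrite !mxE mul_mpolyC.
have NT i j : restrict (row j B) (act (row i N) (row j B)) = F i j *: b j.
  rewrite actN -UC [(U *m C) i j]mxE raddf_sum scaler_suml.
  by apply: eq_bigr => k _; rewrite /= linearZ /= -/(T k j) TE scalerA.
pose D i := \prod_(j | f j == i) linear_form (row j B).
have Df j : D (f j) = linear_form (row j B).
  by rewrite /D (big_pred1 j) // => l; rewrite /= (inj_eq f_inj).
have Dout i : i \notin codom f -> D i = 1.
  move=> iNf; rewrite /D big_pred0 // => j; apply: contraNF iNf => /eqP <-.
  exact: codom_f.
exists (\matrix_(i, k) (D i * N i k)), f; split=> //.
have rowM' i : row i (\matrix_(i, k) (D i * N i k)) = D i *: row i N.
  by apply/rowP => k; rewrite !mxE.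
split=> [i a|p plog|i k].
- rewrite rowM' actZl inE => /orP[aJ|/imfsetP[j _ ->]].
    by rewrite actN; apply/mdvdM/mdvd_sum => k _; apply/mdvdZ/Mlog.
  have [->|ifj] := eqVneq i (f j); first by rewrite Df; exact/mdvdMr/mdvd_refl.
  by apply/mdvdM/restrict_mdvd; rewrite NT mxE (negbTE ifj) scale0r.
- have [|c pE] := Mspan p; first by move=> a aJ; apply: plog; rewrite inE aJ.
  pose g := c *m map_mx (@mpolyC n R) V.
  have {}pE : p = g *m N.
    by rewrite /g /N mulmxA -(mulmxA c) -map_mxM VU map_mx1 mulmx1.
  have /choice[c' c'E] i : exists c', g 0 i = c' * D i.
    have [/codomP[j ->]|/Dout ->] := boolP (i \in codom f); last first.
      by exists (g 0 i); rewrite mulr1.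
    rewrite Df; apply/restrict_mdvd; apply: (mulIf (b0 j)); rewrite mul0r.
    have /restrict_mdvd : mdvd (linear_form (row j B)) (act p (row j B)).
      by apply: plog; rewrite inE; apply/orP; right; apply/imfsetP; exists j.
    rewrite pE act_mulmx raddf_sum (bigD1 (f j)) //= big1 => [|i' i'f].
      by rewrite addr0 rmorphM /= NT [F _ _]mxE eqxx scale1r.
    by rewrite rmorphM /= NT [F _ _]mxE (negbTE i'f) scale0r mulr0.
  exists (\row_i c' i); rewrite pE; apply/rowP => k; rewrite !mxE.
  by apply: eq_bigr => i _; rewrite c'E !mxE mulrA.
rewrite mxE addnC; apply: dhomogM.
  have [/codomP[j ->]|/Dout ->] := boolP (i \in codom f); last exact: dhomog1.
  by rewrite Df linear_form_homog.
rewrite mxE; apply: rpred_sum => l _; rewrite mxE mul_mpolyC.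
have [->|/Ue ->] := eqVneq (U i l) 0; first by rewrite scale0r dhomog0.
exact: rpredZ.
Qed.

End LogarithmicDerivations.

(** * The polynomial dividing the values on a new form *)

Section RestrictionPolynomial.

Variables (R : realType) (n : nat).
Implicit Types (a b x y : 'rV[R]_n) (J : {fset 'rV[R]_n}).
Local Notation mdvd := (@in_principal_ideal R n).

Definition plane a b : {vspace 'rV[R]_n} := (<[a]> + <[b]>)%VS.

Lemma planeP a b y :
  reflect (exists c e, y = c *: b + e *: a) (y \in plane a b).
Proof.
apply: (iffP memv_addP) => [[_ /vlineP[e ->] [_ /vlineP[c ->] ->]]|[c [e ->]]].
  by exists c, e; rewrite addrC.
by exists (e *: a); rewrite ?memvZ ?memv_line //; exists (c *: b);
  rewrite ?memvZ ?memv_line // addrC.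
Qed.

Lemma mem_plane_l a b : a \in plane a b.
Proof. by apply/planeP; exists 0, 1; rewrite scale0r scale1r add0r. Qed.

Lemma mem_plane_r a b : b \in plane a b.
Proof. by apply/planeP; exists 1, 0; rewrite scale0r scale1r addr0. Qed.

Lemma eq_plane a b x c e :
  c != 0 -> x = c *: b + e *: a -> plane a x = plane a b.
Proof.
move=> c0 xE; apply/eqP; rewrite eqEsubv; apply/andP; split.
  rewrite subv_add -!memvE mem_plane_l; apply/planeP; by exists c, e.
rewrite subv_add -!memvE mem_plane_l; apply/planeP; exists c^-1, (- (c^-1 * e)).
by rewrite xE scalerDr !scalerA mulVf // scale1r scaleNr addrK.
Qed.

(** For each form [z] of [L], the hyperplane where [z] vanishes is one where
    [act p z] vanishes as well, and hence also [x * act p y - y * act p x],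
    because [z] is a combination of [x] and [y] involving [x].  So the product
    of the forms of [L] divides this polynomial, which becomes a multiple of
    [x] on the kernel of [y]. *)
Lemma log_derivation_plane J L x y p :
  log_derivation J p -> uniq L -> {subset L <= J} ->
  {in L, forall z, exists c e, c != 0 /\ z = c *: x + e *: y} ->
  {in L, forall z, z != 0} ->
  {in L &, forall z z' (c : R), z = c *: z' -> z = z'} ->
  restrict_form y x != 0 ->
  mdvd (linear_form (restrict_form y x) ^+ (size L).-1) (restrict y (act p y)).
Proof.
move=> plog uL LJ Lxy L0 Lprop rx0.
have [L_0|/eqP L_gt0] := eqVneq (size L) 0%N.
  by rewrite L_0 expr0; exists (restrict y (act p y)); rewrite mulr1.
pose h := linear_form x * act p y - linear_form y * act p x.
have Lh z : z \in L -> mdvd (linear_form z ^+ 1) h.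
  move=> zL; have [c [e [c0 zE]]] := Lxy z zL.
  have -> : h = c^-1 *: (linear_form z * act p y - linear_form y * act p z).
    have -> : linear_form z * act p y - linear_form y * act p z = c *: h.
      rewrite zE 2!linearD 4!(linearZ _ _) /= /h -!mul_mpolyC; ring.
    by rewrite scalerA mulVf // scale1r.
  rewrite expr1; apply/mdvdZ/mdvdB; first exact/mdvdMr/mdvd_refl.
  exact/mdvdM/plog/LJ.
have [u hE] := mdvd_prod_linear_forms uL L0 Lprop Lh.
have [k rprod] : exists k, restrict y (\prod_(z <- L) linear_form z ^+ 1) =
    k *: linear_form (restrict_form y x) ^+ size L.
  elim: (L) Lxy => [|z l IH] Lxy.
    by exists 1; rewrite big_nil rmorph1 expr0 scale1r.
  have [|k kE] := IH; first by move=> w wl; apply: Lxy; rewrite inE wl orbT.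
  have [c [e [c0 zE]]] := Lxy z (mem_head _ _).
  have rz : restrict_form y z = c *: restrict_form y x.
    by rewrite zE linearD !linearZ /= restrict_form_self scaler0 addr0.
  exists (c * k); rewrite big_cons rmorphM /= kE expr1 restrict_linear_form rz.
  by rewrite linearZ /= exprS -!mul_mpolyC mpolyCM; ring.
exists (k *: restrict y u).
have lx0 : linear_form (restrict_form y x) != 0 by rewrite linear_form_eq0.
apply: (mulfI lx0).
have := congr1 (restrict y) hE; rewrite rmorphM /= rprod /h rmorphB !rmorphM /=.
rewrite restrict_linear_form_self mul0r subr0 restrict_linear_form => ->.
have -> : size L = (size L).-1.+1 by lia.
by rewrite exprS -!mul_mpolyC /=; ring.
Qed.

(** Group the forms of [J] by the planes that they span with [b].  Forms of one
    plane restrict to proportional forms on the kernel of [b], and those of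
    different planes do not, so the contributions of [log_derivation_plane]
    are coprime.  The degree of their product is the difference between the
    number of hyperplanes of [J] and the number of their traces on the kernel
    of [b]. *)
Lemma restriction_polynomial J b :
  b != 0 -> {in J, forall a (c : R), a != c *: b} ->
  {in J &, forall a a' (c : R), a = c *: a' -> a = a'} ->
  exists B : {mpoly R[n]},
    [/\ B != 0,
        B \is (\sum_(X <- [fset plane b a | a in J])
                 #|` [fset a in J | plane b a == X]|.-1).-homog
      & forall p, log_derivation J p -> mdvd B (restrict b (act p b))].
Proof.
move=> b0 Jb Jprop; set Xs := imfset _ _ _.
have J0 : {in J, forall a, a != 0}.
  by move=> a aJ; have := Jb a aJ 0; rewrite scale0r.
have /choice[rep repP] (X : {vspace 'rV[R]_n}) :
    exists a, X \in Xs -> a \in J /\ plane b a = X.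
  have [XXs|] := boolP (X \in Xs); last by exists 0.
  by have /imfsetP[a /= aJ ->] := XXs; exists a.
pose F X := restrict_form b (rep X).
have F0 : {in Xs, forall X, F X != 0}.
  move=> X /repP[rJ _]; rewrite /F /restrict_form subr_eq0; exact: Jb.
exists (\prod_(X <- Xs)
          linear_form (F X) ^+ #|` [fset a in J | plane b a == X]|.-1).
split.
- rewrite prodf_seq_neq0; apply/allP => X XXs /=.
  by rewrite expf_neq0 // linear_form_eq0 F0.
- apply: (big_ind2 (fun (g : {mpoly R[n]}) e => g \is e.-homog)) =>
    [|g1 e1 g2 e2|X _].
  + exact: dhomog1.
  + exact: dhomogM.
  by rewrite -[X in X.-homog]mul1n; apply/dhomogMn/linear_form_homog.
move=> p plog; apply: mdvd_prod_linear_forms => //.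
  move=> X X' XXs X'Xs c; rewrite /F /restrict_form.
  have [rJ rX] := repP X XXs; have [rJ' rX'] := repP X' X'Xs.
  set u := pairing _ _; set u' := pairing _ _ => /eqP; rewrite subr_eq => /eqP rE.
  rewrite -{}rX -{}rX'; apply: (@eq_plane _ _ _ c (u - c * u')); last first.
    by rewrite rE scalerBr scalerA scalerBl addrAC -addrA.
  apply: contra (Jb _ rJ u) => /eqP c0.
  by rewrite rE c0 scale0r add0r.
move=> X XXs; have [rJ rX] := repP X XXs.
apply: (log_derivation_plane plog); rewrite ?fset_uniq //.
- by move=> a; rewrite !inE => /andP[].
- move=> a; rewrite !inE => /andP[aJ /eqP aX].
  have /planeP[c [e aE]] : a \in plane b (rep X) by rewrite rX -aX mem_plane_r.
  exists c, e; split=> //; apply: contra (Jb a aJ e) => /eqP c0.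
  by rewrite aE c0 scale0r add0r.
- by move=> a; rewrite !inE => /andP[aJ _]; exact: J0.
- by move=> a a'; rewrite !inE => /andP[aJ _] /andP[a'J _] c; exact: Jprop.
exact: F0.
Qed.

End RestrictionPolynomial.

(** * The invariant scalar product of a root system *)

Lemma sum_involution (V : zmodType) (T : choiceType) (A : {fset T}) (s : T -> T)
    (F : T -> V) :
  {in A, forall a, s a \in A} -> {in A, forall a, s (s a) = a} ->
  \sum_(a <- A) F (s a) = \sum_(a <- A) F a.
Proof.
move=> sA ss; rewrite -(big_map s xpredT F); apply/perm_big/uniq_perm.
- rewrite map_inj_in_uniq ?fset_uniq // => a b aA bA sab.
  by rewrite -(ss a aA) sab ss.
- exact: fset_uniq.
move=> a; apply/mapP/idP => [[b bA ->]|aA]; first exact: sA.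
by exists (s a); rewrite ?ss // sA.
Qed.

Section RootSystem.

Local Notation roots := Defs.roots.
Variables (R : realType) (n : nat) (Phi : root_system R n).
Implicit Types (a b c d u v : 'rV[R]_n) (x : 'cV[R]_n).

Lemma pairing_span x :
  (forall a, a \in roots Phi -> pairing a x = 0) -> x = 0.
Proof.
move=> Px; have all0 u : pairing u x = 0.
  have : u \in <<roots Phi>>%VS by rewrite roots_span memvf.
  move=> uP; rewrite (@coord_span _ _ _ (in_tuple (enum_fset (roots Phi))) _ uP).
  rewrite pairing_suml big1 // => i _.
  by rewrite pairingZl Px ?mulr0 //; apply: mem_nth; exact: ltn_ord.
apply/colP => i; rewrite mxE; have := all0 (delta_mx 0 i).
by rewrite /pairing -rowE mxE.
Qed.

Definition gram : 'M[R]_n := \sum_(a <- roots Phi) a^T *m a.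

Lemma mulmx_gram x : gram *m x = \sum_(a <- roots Phi) pairing a x *: a^T.
Proof.
rewrite mulmx_suml; apply: eq_bigr => a _.
by rewrite -mulmxA [a *m x]mx11_scalar mul_mx_scalar.
Qed.

Lemma gram_unit : gram \in unitmx.
Proof.
rewrite -unitmx_tr -row_free_unit -kermx_eq0; apply/eqP/row_matrixP => i.
rewrite row0; set v := row i _; have vG : v *m gram^T = 0.
  by apply/sub_kermxP; exact: row_sub.
apply: trmx_inj; rewrite trmx0; apply: pairing_span => a aPhi.
have : pairing v (gram *m v^T) = 0.
  by rewrite -[gram]trmxK -trmx_mul vG trmx0 pairing0r.
rewrite mulmx_gram pairing_sumr.
have sqE b : pairing v (pairing b v^T *: b^T) = pairing b v^T ^+ 2.
  rewrite pairingZr expr2; congr (_ * _).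
  by rewrite /pairing -{1}(trmxK v) -trmx_mul mxE.
under eq_bigr do rewrite sqE.
rewrite (big_rem a) //= => /eqP; rewrite paddr_eq0 ?sqr_ge0 //; last first.
  by apply: sumr_ge0 => b _; exact: sqr_ge0.
by move=> /andP[]; rewrite sqrf_eq0 => /eqP.
Qed.

(** The vector representing the functional [u] with respect to the form
    [sum_a pairing a x * pairing a y] on vectors; that form is invariant under
    reflections because they permute the roots. *)
Definition dual u : 'cV[R]_n := invmx gram *m u^T.

Definition ip u v : R :=
  \sum_(a <- roots Phi) pairing a (dual u) * pairing a (dual v).

Lemma ipE u v : ip u v = pairing u (dual v).
Proof.
have uE : u = \sum_(a <- roots Phi) pairing a (dual u) *: a.
  apply: trmx_inj; rewrite raddf_sum /=.
  under eq_bigr do rewrite linearZ /=.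
  by rewrite -mulmx_gram mulKVmx // gram_unit.
rewrite [u in RHS]uE pairing_suml; apply: eq_bigr => a _.
by rewrite pairingZl.
Qed.

Lemma ipC u v : ip u v = ip v u.
Proof. by apply: eq_bigr => a _; rewrite mulrC. Qed.
Lemma ipDl u v w : ip (u + v) w = ip u w + ip v w.
Proof. by rewrite !ipE pairingDl. Qed.
Lemma ipZl k u v : ip (k *: u) v = k * ip u v.
Proof. by rewrite !ipE pairingZl. Qed.
Lemma ipNl u v : ip (- u) v = - ip u v.
Proof. by rewrite !ipE pairingNl. Qed.
Lemma ipBl u v w : ip (u - v) w = ip u w - ip v w.
Proof. by rewrite ipDl ipNl. Qed.
Lemma ipZr k u v : ip u (k *: v) = k * ip u v.
Proof. by rewrite ipC ipZl ipC. Qed.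
Lemma ipDr u v w : ip w (u + v) = ip w u + ip w v.
Proof. by rewrite ![ip w _]ipC ipDl. Qed.
Lemma ipNr u v : ip v (- u) = - ip v u.
Proof. by rewrite ![ip v _]ipC ipNl. Qed.
Lemma ipBr u v w : ip w (u - v) = ip w u - ip w v.
Proof. by rewrite ipDr ipNr. Qed.
Lemma ip0l u : ip 0 u = 0.
Proof. by rewrite ipE pairing0l. Qed.
Lemma ip_suml (I : Type) (r : seq I) (P : pred I) F u :
  ip (\sum_(i <- r | P i) F i) u = \sum_(i <- r | P i) ip (F i) u.
Proof. exact: (big_morph _ (fun v w => ipDl v w u) (ip0l u)). Qed.
Lemma ip_sumr (I : Type) (r : seq I) (P : pred I) F u :
  ip u (\sum_(i <- r | P i) F i) = \sum_(i <- r | P i) ip u (F i).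
Proof. by rewrite ipC ip_suml; apply: eq_bigr => i _; rewrite ipC. Qed.

Lemma ip_ge0 u : 0 <= ip u u.
Proof. by apply: sumr_ge0 => a _; rewrite -expr2 sqr_ge0. Qed.

Lemma ip_eq0 u : ip u u = 0 -> u = 0.
Proof.
move=> u0; have du : dual u = 0.
  apply: pairing_span => a aPhi; move/eqP: u0; rewrite /ip (big_rem a) //=.
  rewrite paddr_eq0 -?expr2 ?sqr_ge0 //; last first.
    by apply: sumr_ge0 => b _; rewrite -expr2 sqr_ge0.
  by move=> /andP[]; rewrite sqrf_eq0 => /eqP.
apply: trmx_inj; rewrite -(mulKVmx gram_unit u^T) -/(dual u) du.
by rewrite mulmx0 trmx0.
Qed.

Lemma ip_gt0 u : u != 0 -> 0 < ip u u.
Proof.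
by move=> u0; rewrite lt_def ip_ge0 andbT; apply: contra u0 => /eqP/ip_eq0 ->.
Qed.

Definition refl a b := b - pairing b (coroot Phi a) *: a.

Lemma root_nz a : a \in roots Phi -> a != 0.
Proof. by apply: contraTneq => ->; exact: root_neq0. Qed.

Lemma refl_root a b :
  a \in roots Phi -> b \in roots Phi -> refl a b \in roots Phi.
Proof. exact: reflection_root. Qed.

Lemma pairing_refl a b :
  a \in roots Phi -> pairing (refl a b) (coroot Phi a) = - pairing b (coroot Phi a).
Proof.
by move=> aPhi; rewrite pairingBl pairingZl (pairing_coroot aPhi); ring.
Qed.

Lemma reflK a b : a \in roots Phi -> refl a (refl a b) = b.
Proof.
by move=> aPhi; rewrite {1}/refl pairing_refl // scaleNr opprK subrK.
Qed.

Lemma refl_self a : a \in roots Phi -> refl a a = - a.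
Proof.
move=> aPhi; rewrite /refl (pairing_coroot aPhi) scaler_nat mulr2n.
by rewrite opprD addNKr.
Qed.

Lemma opp_root a : a \in roots Phi -> - a \in roots Phi.
Proof. by move=> aPhi; rewrite -refl_self // refl_root. Qed.

(** The reindexing of the sum over all roots by the reflection in [a] shows
    that the Gram matrix maps the coroot of [a] to a positive multiple of
    [a]. *)
Lemma dual_root a :
  a \in roots Phi -> exists2 k, 0 < k & dual a = k *: coroot Phi a.
Proof.
move=> aPhi; set x := coroot Phi a.
pose s := \sum_(b <- roots Phi) pairing b x ^+ 2.
have s_gt0 : 0 < s.
  rewrite /s (big_rem a) //= (pairing_coroot aPhi) ltr_pwDl ?exprn_gt0 //.
  by apply: sumr_ge0 => b _; exact: sqr_ge0.
have Gx : gram *m x = (s / 2) *: a^T.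
  apply: trmx_inj; rewrite mulmx_gram raddf_sum linearZ /= trmxK.
  under eq_bigr do rewrite linearZ /= trmxK.
  set S := \sum_(b <- _) _; have SE : S = s *: a - S.
    rewrite {1}/S -(@sum_involution _ _ _ (refl a)); first last.
    - by move=> b _; exact: reflK.
    - by move=> b; exact: refl_root.
    rewrite /S /s scaler_suml -sumrB; apply: eq_bigr => b _.
    rewrite pairing_refl // scalerBr scalerA scaleNr mulNr scaleNr expr2.
    by rewrite opprK addrC.
  have : S + S = s *: a by rewrite {1}SE subrK.
  rewrite -mulr2n => /(congr1 (fun v => 2^-1 *: v)).
  by rewrite scalerA -scaler_nat scalerA mulVf ?pnatr_eq0 // scale1r mulrC.
exists (s / 2)^-1; first by rewrite invr_gt0 divr_gt0.
have s2 : s / 2 != 0 by rewrite gt_eqF // divr_gt0.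
rewrite /dual -[a^T](scalerK s2) -Gx linearZ /= mulKmx //.
exact: gram_unit.
Qed.

Lemma ip_root a b :
  a \in roots Phi -> 2 * ip b a = ip a a * pairing b (coroot Phi a).
Proof.
move=> aPhi; have [k _ aE] := dual_root aPhi.
by rewrite !ipE aE !pairingZr (pairing_coroot aPhi); ring.
Qed.

Lemma ip_refl a u v : a \in roots Phi -> ip (refl a u) (refl a v) = ip u v.
Proof.
move=> aPhi; rewrite /refl !ipBl !ipBr !ipZl !ipZr.
have ua := ip_root u aPhi; have va := ip_root v aPhi.
rewrite (ipC a v); set p := pairing u _ in ua *; set q := pairing v _ in va *.
have -> : ip u a = ip a a * p / 2 by rewrite -ua; field.
have -> : ip v a = ip a a * q / 2 by rewrite -va; field.
by field.
Qed.

Lemma pairing_coroot_refl a b :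
  a \in roots Phi -> b \in roots Phi ->
  pairing a (coroot Phi (refl a b)) = - pairing a (coroot Phi b).
Proof.
move=> aPhi bPhi; have b0 : ip b b != 0 by rewrite gt_eqF // ip_gt0 // root_nz.
apply: (mulfI b0); rewrite mulrN -(ip_root _ bPhi) -{1}(ip_refl b b aPhi).
rewrite -ip_root ?refl_root // -{1}(reflK a aPhi) ip_refl //.
by rewrite refl_self // ipNl mulrN.
Qed.

(** Two roots with positive scalar product and different from each other have
    one of their two (positive integer) Cartan numbers equal to 1, by
    Cauchy-Schwarz. *)
Lemma sub_root a b :
  a \in roots Phi -> b \in roots Phi -> a != b -> 0 < ip a b ->
  a - b \in roots Phi.
Proof.
move=> aPhi bPhi ab ip_ab.
have aa := ip_gt0 (root_nz aPhi); have bb := ip_gt0 (root_nz bPhi).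
have abE := ip_root a bPhi; have baE := ip_root b aPhi; rewrite ipC in baE.
have := pairing_int bPhi aPhi; have := pairing_int aPhi bPhi.
move=> /intrP[q qE] /intrP[p pE]; rewrite pE in abE; rewrite qE in baE.
have p0 : (0 < p)%R.
  by rewrite -(ltr0z R) -(pmulr_rgt0 _ bb) -abE mulr_gt0.
have q0 : (0 < q)%R.
  by rewrite -(ltr0z R) -(pmulr_rgt0 _ aa) -baE mulr_gt0.
have [p1|p_neq1] := eqVneq p 1.
  by have := refl_root bPhi aPhi; rewrite /refl pE p1 scale1r.
have [q1|q_neq1] := eqVneq q 1.
  have := refl_root aPhi bPhi; rewrite /refl qE q1 scale1r -opprB.
  by move=> /opp_root; rewrite opprK.
have p2 : 2 <= p%:~R :> R by rewrite (ler_int R 2); lia.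
have q2 : 2 <= q%:~R :> R by rewrite (ler_int R 2); lia.
have w0 : a - (p%:~R / 2) *: b = 0.
  apply: ip_eq0; apply/eqP; rewrite eq_le ip_ge0 andbT.
  rewrite !(ipBl, ipBr, ipZl, ipZr) (ipC b a).
  move: abE baE p2 q2 aa; set P := p%:~R; set Q := q%:~R.
  set A := ip a a; set B := ip b b; set C := ip a b => abE baE P2 Q2 A0.
  have -> : A - P / 2 * C - (P / 2 * C - P / 2 * (P / 2 * B)) =
            A - P * C + P / 4 * (B * P) by field.
  rewrite -abE; have -> : C = A * Q / 2 by lra.
  have -> : A - P * (A * Q / 2) + P / 4 * (2 * (A * Q / 2)) = A * (1 - P * Q / 4).
    by field.
  by rewrite pmulr_rle0 //; nra.
have /(roots_reduced bPhi)[] : (p%:~R / 2) *: b \in roots Phi.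
- by move/eqP: w0; rewrite subr_eq0 => /eqP <-.
- by move=> p2E; move/eqP: w0; rewrite p2E scale1r subr_eq0 (negbTE ab).
have : 0 < p%:~R / 2 :> R by rewrite divr_gt0 // ltr0z.
by move=> + pE'; rewrite pE' oppr_gt0 ltr10.
Qed.

End RootSystem.

(** * Positive systems of subsystems and the sum of positive coroots *)

Section PositiveSystems.

Local Notation roots := Defs.roots.
Variables (R : realType) (n : nat) (Phi : root_system R n).
Implicit Types (a b c d e g u v : 'rV[R]_n) (h x : 'cV[R]_n).
Local Notation ip := (ip Phi).
Local Notation coroot := (coroot Phi).

(** A vanishing combination of pairwise obtuse vectors splits into a positive
    and a negative part, which are equal vectors with nonpositive scalar
    product, hence zero; being on one side of a hyperplane then kills all
    coefficients. *)
Lemma obtuse_independent (I : finType) (v : I -> 'rV[R]_n) h (k : I -> R) :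
  (forall i j, i != j -> ip (v i) (v j) <= 0) ->
  (forall i, 0 < pairing (v i) h) ->
  \sum_i k i *: v i = 0 -> forall i, k i = 0.
Proof.
move=> obt pos sum0.
pose p i := Num.max (k i) 0; pose m i := Num.max (- k i) 0.
have kE i : k i = p i - m i.
  by rewrite /p /m; case: (lerP (k i) 0); case: (lerP (- k i) 0); lra.
have p0 i : 0 <= p i by rewrite le_max lexx orbT.
have m0 i : 0 <= m i by rewrite le_max lexx orbT.
have pm i : p i * m i = 0.
  by rewrite /p /m; case: (lerP (k i) 0); case: (lerP (- k i) 0); nra.
pose w := \sum_i p i *: v i.
have wE : w = \sum_i m i *: v i.
  apply/eqP; rewrite -subr_eq0 -sumrB -[X in _ == X]sum0; apply/eqP.
  by apply: eq_bigr => i _; rewrite kE scalerBl.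
have w0 : w = 0.
  apply: (@ip_eq0 _ _ Phi); apply/eqP; rewrite eq_le ip_ge0 andbT {2}wE ip_suml.
  apply: sumr_le0 => i _; rewrite ip_sumr; apply: sumr_le0 => j _.
  rewrite ipZl ipZr mulrA; have [<-|ij] := eqVneq i j; first by rewrite pm mul0r.
  by rewrite mulr_ge0_le0 ?mulr_ge0 // obt.
have zero (q : I -> R) : (forall i, 0 <= q i) -> \sum_i q i *: v i = 0 ->
    forall i, q i = 0.
  move=> q0 qw i.
  have : \sum_i q i * pairing (v i) h = 0.
    rewrite -[RHS](pairing0l h) -qw pairing_suml.
    by apply: eq_bigr => j _; rewrite pairingZl.
  move/psumr_eq0P => /(_ _ i isT) qh; apply/eqP.
  rewrite -(mulIr_eq0 _ (mulIf (lt0r_neq0 (pos i)))) qh //.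
  by move=> j _; rewrite mulr_ge0 // ltW.
by move=> i; rewrite kE (zero p p0 w0) (zero m m0) ?subrr // -wE.
Qed.

Lemma obtuse_free (s : seq 'rV[R]_n) h :
  uniq s -> {in s &, forall a b, a != b -> ip a b <= 0} ->
  {in s, forall a, 0 < pairing a h} -> free s.
Proof.
move=> us obt pos; rewrite -[s]/(tval (in_tuple s)); apply/freeP => k /=.
apply: (@obtuse_independent _ (fun i : 'I_(size s) => s`_i) h) => [i j ij|i].
  by apply: obt; rewrite ?mem_nth // nth_uniq.
by apply: pos; rewrite mem_nth.
Qed.

Section Subsystem.

(** The subsystems of interest consist of all roots, of the roots in a plane,
    and of the roots whose level is a multiple of a given number; each is cut
    out by a subgroup [P]. *)
Variables (P : {pred 'rV[R]_n}) (h : 'cV[R]_n).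
Hypothesis PB : forall a b, a \in P -> b \in P -> a - b \in P.
Hypothesis h_reg : forall a, a \in roots Phi -> a \in P -> pairing a h != 0.

Definition positive := [fset a in roots Phi | (a \in P) && (0 < pairing a h)].

Definition indecomposable d : Prop :=
  d \in positive /\
  forall a b, a \in positive -> b \in positive -> d <> a + b.

Lemma positiveP a :
  reflect [/\ a \in roots Phi, a \in P & 0 < pairing a h] (a \in positive).
Proof. by rewrite !inE; apply: (iffP and3P). Qed.

Lemma subgroupN a : a \in P -> - a \in P.
Proof. by move=> aP; rewrite -sub0r -(subrr a) !PB. Qed.

Lemma subgroupD a b : a \in P -> b \in P -> a + b \in P.
Proof. by move=> aP bP; rewrite -[b]opprK PB // subgroupN. Qed.

Lemma subgroupMn a (m : nat) : a \in P -> m%:R *: a \in P.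
Proof.
move=> aP; elim: m => [|m IH]; first by rewrite scale0r -(subrr a) PB.
by rewrite -natr1 scalerDl scale1r subgroupD.
Qed.

Lemma refl_subgroup a b :
  a \in roots Phi -> b \in roots Phi -> a \in P -> b \in P -> refl Phi a b \in P.
Proof.
move=> aPhi bPhi aP bP; rewrite /refl.
have /intrP[[m|m] ->] := pairing_int aPhi bPhi.
  by rewrite PB // subgroupMn.
by rewrite NegzE rmorphN scaleNr opprK subgroupD // subgroupMn.
Qed.

Lemma positiveVopp a :
  a \in roots Phi -> a \in P -> a \in positive \/ - a \in positive.
Proof.
move=> aPhi aP; have := h_reg aPhi aP; rewrite neq_lt => /orP[a0|a0].
  by right; apply/positiveP; rewrite opp_root // subgroupN // pairingNl oppr_gt0.
by left; apply/positiveP.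
Qed.

Lemma positive_double a c : a \in positive -> c \in positive ->
  forall k : R, c = k *: a -> k = 1.
Proof.
move=> /positiveP[aPhi _ a0] /positiveP[cPhi _ c0] k cE.
have := cPhi; rewrite cE => /(roots_reduced aPhi)[] // k1.
by move: c0; rewrite cE k1 scaleN1r pairingNl oppr_gt0 ltNge ltW.
Qed.

Lemma positive_sub a b :
  a \in positive -> b \in positive -> a - b \in roots Phi ->
  a - b \in positive \/ b - a \in positive.
Proof.
move=> /positiveP[_ aP _] /positiveP[_ bP _] abPhi.
by rewrite -(opprB a b); apply: positiveVopp => //; exact: PB.
Qed.

Lemma indecomposable_sub d g :
  indecomposable d -> g \in positive -> g - d \in roots Phi -> g - d \in positive.
Proof.
move=> [dpos dind] gpos gd; have [//|dg] := positive_sub gpos dpos gd.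
by case: (dind _ _ gpos dg); rewrite addrC subrK.
Qed.

Lemma indecomposable_obtuse d d' :
  indecomposable d -> indecomposable d' -> d != d' -> ip d d' <= 0.
Proof.
move=> dind d'ind dd'; rewrite leNgt; apply/negP => dd'_gt0.
have [dpos dmin] := dind; have [d'pos _] := d'ind.
have /positiveP[dPhi _ _] := dpos; have /positiveP[d'Phi _ _] := d'pos.
have := sub_root dPhi d'Phi dd' dd'_gt0.
move=> /(indecomposable_sub d'ind dpos) => sub.
by case: (dmin _ _ sub d'pos); rewrite subrK.
Qed.

(** One of the two summands has positive scalar product with [d], so it can be
    reduced by [d] without leaving the positive
    system, which lowers [k]. *)
Lemma indecomposable_not_sum d g e (k : nat) :
  indecomposable d -> g \in positive -> e \in positive -> g != d -> e != d ->
  g + e != k%:R *: d.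
Proof.
move=> dind; have [dpos _] := dind; have /positiveP[dPhi _ d0] := dpos.
elim: k g e => [|k IH] g e gpos epos gd ed.
  apply/eqP => /(congr1 (fun v => pairing v h)).
  rewrite scale0r pairing0l pairingDl.
  have /positiveP[_ _ g0] := gpos; have /positiveP[_ _ e0] := epos.
  by move/eqP; rewrite gt_eqF // addr_gt0.
apply/negP => /eqP geE.
wlog gd0 : g e gpos epos gd ed geE / 0 < ip g d.
  move=> W; have : 0 < ip g d + ip e d.
    by rewrite -ipDl geE ipZl mulr_gt0 ?ltr0n // ip_gt0 // (@root_nz _ _ Phi).
  have [g0 _|g0 ge] := ltrP 0 (ip g d); first exact: (W g e).
  by apply: (W e g) => //; [rewrite addrC|lra].
have /positiveP[gPhi _ _] := gpos.
have gdpos : g - d \in positive.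
  exact/(indecomposable_sub dind gpos)/sub_root.
have gdd : g - d != d.
  apply/negP; rewrite subr_eq => /eqP gE.
  have gE2 : g = 2 *: d by rewrite gE scaler_nat mulr2n.
  by have /eqP := positive_double dpos gpos gE2; rewrite pnatr_eq1.
have /negP := IH _ _ gdpos epos gdd ed; apply; apply/eqP.
by rewrite addrAC geE -natr1 scalerDl scale1r addrK.
Qed.

Lemma indecomposable_refl d g :
  indecomposable d -> g \in positive -> g != d -> refl Phi d g \in positive.
Proof.
move=> dind gpos gd; have [dpos _] := dind.
have /positiveP[dPhi dP d0] := dpos; have /positiveP[gPhi gP g0] := gpos.
have [//|e_pos] :=
  positiveVopp (refl_root dPhi gPhi) (refl_subgroup dPhi gPhi dP gP).
set e := - refl Phi d g in e_pos; have /positiveP[_ _ e0] := e_pos.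
have geE : g + e = pairing g (coroot d) *: d.
  by rewrite /e /refl opprB addrCA subrr addr0.
have /intrP[k kE] := pairing_int dPhi gPhi; rewrite kE in geE.
have k0 : (0 < k)%R.
  rewrite -(ltr0z R) -(pmulr_lgt0 _ d0) -pairingZl -geE pairingDl.
  exact: addr_gt0.
case: k => [k|//] in kE geE k0 *.
have [ed|ed] := eqVneq e d; last first.
  by have := indecomposable_not_sum k dind gpos e_pos gd ed; rewrite geE eqxx.
have gE : g = (k%:R - 1) *: d.
  by rewrite scalerBl scale1r -[k%:R]/((Posz k)%:~R) -geE ed addrK.
have k1 := positive_double dpos gpos gE.
by move: gd; rewrite gE k1 scale1r eqxx.
Qed.

Definition rho : 'cV[R]_n := \sum_(g <- positive) coroot g.

(** The reflection in [d] permutes the positive roots other than [d], and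
    changes the sign of their contributions. *)
Lemma pairing_rho d : indecomposable d -> pairing d rho = 2.
Proof.
move=> dind; have [dpos _] := dind; have /positiveP[dPhi _ _] := dpos.
rewrite pairing_sumr (big_fsetD1 d) //= (pairing_coroot dPhi).
set S := \sum_(g <- _) _; suff: S = - S.
  by move=> SE; have -> : S = 0 by [lra]; rewrite addr0.
rewrite {1}/S -(@sum_involution _ _ _ (refl Phi d)); first last.
- by move=> g _; exact: reflK.
- move=> g; rewrite !in_fsetD1 => /andP[gd gpos].
  rewrite indecomposable_refl // andbT; apply: contraTneq gpos => gE.
  rewrite -(reflK g dPhi) gE refl_self //; apply/negP => /positiveP[_ _].
  by have /positiveP[_ _ d0] := dpos; rewrite pairingNl oppr_gt0 ltNge ltW.
rewrite -sumrN !big_seq; apply: eq_bigr => g; rewrite in_fsetD1 => /andP[_].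
by move=> /positiveP[gPhi _ _]; rewrite pairing_coroot_refl.
Qed.

Lemma pairing_rho_int a : a \in roots Phi -> pairing a rho \is a Num.int.
Proof.
move=> aPhi; rewrite pairing_sumr big_seq; apply: rpred_sum => g.
by move=> /positiveP[gPhi _ _]; exact: pairing_int.
Qed.

Lemma positive_ind (Q : 'rV[R]_n -> Prop) :
  (forall a, a \in positive ->
     (forall b, b \in positive -> pairing b h < pairing a h -> Q b) -> Q a) ->
  forall a, a \in positive -> Q a.
Proof.
move=> step a.
have [m] := ubnP #|` [fset b in positive | pairing b h < pairing a h]|.
elim: m a => // m IH a; rewrite ltnS => am apos; apply: step => // b bpos ba.
apply: IH => //; apply: leq_trans am; apply: fproper_ltn_card.
rewrite fproperE; apply/andP; split.
  apply/fsubsetP => c; rewrite !inE /= => /andP[-> cb].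
  exact: lt_trans cb ba.
have /positiveP[bPhi bP b0] := bpos.
by apply/fsubsetPn; exists b; rewrite !inE /= ?ltxx ?andbF // bPhi bP b0.
Qed.

Lemma indecomposable_or_sum a : a \in positive ->
  indecomposable a \/ exists b c, [/\ b \in positive, c \in positive & a = b + c].
Proof.
move=> apos; have [|na] := lem (indecomposable a); [by left|right].
apply: contrapT => nex; apply: na; split=> // b c bpos cpos abc.
by apply: nex; exists b, c.
Qed.

(** Half of this value is the number of summands when [a] is written as a sum
    of indecomposable roots, that is, the height of [a] in its subsystem. *)
Lemma rho_positive a : a \in positive ->
  exists k : nat, pairing a rho = 2 * k.+1%:R.
Proof.
elim/positive_ind: a / => a apos IH.
have [/pairing_rho->|[b [c [bpos cpos aE]]]] := indecomposable_or_sum apos.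
  by exists 0%N; rewrite mulr1.
have /positiveP[_ _ b0] := bpos; have /positiveP[_ _ c0] := cpos.
have [k kE] : exists k : nat, pairing b rho = 2 * k.+1%:R.
  by apply: IH => //; rewrite aE pairingDl ltrDl.
have [l lE] : exists k : nat, pairing c rho = 2 * k.+1%:R.
  by apply: IH => //; rewrite aE pairingDl ltrDr.
by exists (k + l).+1; rewrite aE pairingDl kE lE -mulrDr -natrD addSn addnS.
Qed.

Lemma rho2_indecomposable a :
  a \in positive -> pairing a rho = 2 -> indecomposable a.
Proof.
move=> apos a2; split=> // b c /rho_positive[k kE] /rho_positive[l lE] aE.
move: a2; rewrite aE pairingDl kE lE -mulrDr -natrD -[RHS]mulr1.
have two : 2 != 0 :> R by rewrite pnatr_eq0.
by move/(mulfI two)/eqP; rewrite pnatr_eq1 addSn addnS.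
Qed.

(** Otherwise [a] would have nonpositive scalar product with all indecomposable
    roots, hence with all sums of them, such as [a] itself. *)
Lemma exists_indecomposable_sub a : a \in positive -> ~ indecomposable a ->
  exists2 d, indecomposable d & a - d \in positive.
Proof.
move=> apos aind; have /positiveP[aPhi _ _] := apos.
apply: contrapT => nex.
have obt d : indecomposable d -> ip a d <= 0.
  move=> dind; rewrite leNgt; apply/negP => ad0; apply: nex; exists d => //.
  have [dpos _] := dind; have /positiveP[dPhi _ _] := dpos.
  apply: indecomposable_sub => //; apply: sub_root => //.
  by apply/eqP => ad; apply: aind; rewrite ad.
have {}obt : forall b, b \in positive -> ip a b <= 0.
  apply: positive_ind => b bpos IH.
  have [/obt//|[c [d [cpos dpos bE]]]] := indecomposable_or_sum bpos.
  have /positiveP[_ _ c0] := cpos; have /positiveP[_ _ d0] := dpos.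
  rewrite bE ipDr -[leRHS](addr0 0); apply: lerD; apply: IH => //.
    by rewrite bE pairingDl ltrDl.
  by rewrite bE pairingDl ltrDr.
by have := obt a apos; rewrite leNgt ip_gt0 // (@root_nz _ _ Phi).
Qed.

End Subsystem.

End PositiveSystems.

(** * Roots of the same level *)

Section Levels.

Local Notation roots := Defs.roots.
Variables (R : realType) (n : nat) (Phi : root_system R n).
Implicit Types (a b c d e g u v : 'rV[R]_n) (h x : 'cV[R]_n).
Local Notation ip := (ip Phi).
Local Notation coroot := (coroot Phi).

Lemma span_pairing (s : seq 'rV[R]_n) x :
  {in s, forall b, pairing b x = 0} -> forall v, v \in <<s>>%VS -> pairing v x = 0.
Proof.
move=> sx v vs; rewrite (@coord_span _ _ _ (in_tuple s) _ vs).
rewrite pairing_suml big1 // => i _; rewrite pairingZl sx ?mulr0 //.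
exact/mem_nth/ltn_ord.
Qed.

Lemma le_sum1 (I : eqType) (s : seq I) (F : I -> R) i :
  (forall j, 0 <= F j) -> i \in s -> F i <= \sum_(j <- s) F j.
Proof. by move=> F0 si; rewrite (big_rem i) //= lerDl sumr_ge0. Qed.

Lemma le_sum2 (I : eqType) (s : seq I) (F : I -> R) i j :
  (forall k, 0 <= F k) -> i \in s -> j \in s -> i != j ->
  F i + F j <= \sum_(k <- s) F k.
Proof.
move=> F0 si sj ij; rewrite (big_rem i) //= lerD2l le_sum1 //.
by move: sj; rewrite (perm_mem (perm_to_rem si)) inE eq_sym (negbTE ij).
Qed.

(** If the scalar product were positive, the difference would be a root on
    which [h] vanishes. *)
Lemma same_level_obtuse (U : {vspace 'rV[R]_n}) h b c :
  (forall a, a \in roots Phi -> a \in U -> pairing a h != 0) ->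
  b \in roots Phi -> c \in roots Phi -> b \in U -> c \in U -> b != c ->
  pairing b h = pairing c h -> ip b c <= 0.
Proof.
move=> hU bPhi cPhi bU cU bc hbc; rewrite leNgt; apply/negP => bc0.
have := hU _ (sub_root bPhi cPhi bc bc0) (rpredB bU cU).
by rewrite pairingBl hbc subrr eqxx.
Qed.

(** The left-hand side is the cosine of the angle.  Four times its square is
    the product of two negative integers. *)
Lemma ip_obtuse_roots b c : b \in roots Phi -> c \in roots Phi -> ip b c < 0 ->
  (Num.sqrt (ip b b))^-1 * (Num.sqrt (ip c c))^-1 * ip b c <= - (1 / 2).
Proof.
move=> bPhi cPhi bc0.
have bb := ip_gt0 Phi (root_nz bPhi); have cc := ip_gt0 Phi (root_nz cPhi).
have bE := ip_root c bPhi; have cE := ip_root b cPhi; rewrite ipC in bE.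
have /intrP[p pE] := pairing_int bPhi cPhi.
have /intrP[q qE] := pairing_int cPhi bPhi.
rewrite pE in bE; rewrite qE in cE.
have p0 : (p < 0)%R by rewrite -(ltrz0 R) -(pmulr_rlt0 _ bb) -bE; lra.
have q0 : (q < 0)%R by rewrite -(ltrz0 R) -(pmulr_rlt0 _ cc) -cE; lra.
have p1 : p%:~R <= -1 :> R by rewrite (ler_int R p (-1)); lia.
have q1 : q%:~R <= -1 :> R by rewrite (ler_int R q (-1)); lia.
have sb : 0 < Num.sqrt (ip b b) by rewrite sqrtr_gt0.
have sc : 0 < Num.sqrt (ip c c) by rewrite sqrtr_gt0.
have sbE := sqr_sqrtr (ltW bb); have scE := sqr_sqrtr (ltW cc).
move: sbE scE sb sc bE cE p1 q1 bc0.
set B := Num.sqrt _; set C := Num.sqrt _; set x := ip b c.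
set P := p%:~R; set Q := q%:~R.
move=> <- <- B0 C0 xP xQ P1 Q1 x0.
have key : B * C <= - (2 * x).
  rewrite -(ler_pXn2r (_ : 0 < 2)%N) // ?nnegrE; [|nra|lra].
  have -> : (- (2 * x)) ^+ 2 = (2 * x) * (2 * x) by ring.
  rewrite {1}xP xQ.
  have -> : B ^+ 2 * P * (C ^+ 2 * Q) = (B * C) ^+ 2 * (P * Q) by ring.
  by rewrite ler_peMr ?sqr_ge0 //; nra.
rewrite -invfM mulrC ler_pdivrMr ?mulr_gt0 //; lra.
Qed.

(** If many roots [L] sit at the same level [N], then no root of their span
    sits at a lower positive level.  For the subsystem of the roots whose level
    is a multiple of [N], all of [L] is indecomposable; twice the level divided
    by [N] is thus given by the sum of its positive coroots and takes integer
    values, so a lower positive level would be exactly [N / 2].  The roots of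
    level [N / 2], together with those roots of level [N] that are not sums of
    two of them, form an obtuse family, so there are at most [#|L|] of them.
    Finally, in an obtuse family of [r] roots there are fewer than [r] pairs
    whose sum is a root, since the sum of the normalised roots has positive
    square length.  This leaves fewer than [#|L|] roots of level [N],
    which is absurd. *)
Theorem level_gap h (L : {fset 'rV[R]_n}) (N : R) :
  0 < N -> {in L, forall b, b \in roots Phi /\ pairing b h = N} ->
  (forall a, a \in roots Phi -> a \in <<L>>%VS -> pairing a h != 0) ->
  forall a, a \in roots Phi -> a \in <<L>>%VS -> 0 < pairing a h ->
  N <= pairing a h.
Proof.
move=> N0 LN hU a aPhi aU a0; rewrite leNgt; apply/negP => aN.
set U := <<L>>%VS in hU aU.
pose P0 : {pred 'rV[R]_n} :=
  [pred v | (v \in U) && (pairing v h / N \is a Num.int)].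
have P0B u v : u \in P0 -> v \in P0 -> u - v \in P0.
  rewrite !inE => /andP[uU uN] /andP[vU vN]; rewrite rpredB //=.
  by rewrite pairingBl mulrBl rpredB.
have P0reg b : b \in roots Phi -> b \in P0 -> pairing b h != 0.
  by rewrite inE => bPhi /andP[bU _]; exact: hU.
have LU b : b \in L -> b \in U by move=> bL; exact: memv_span.
have Lind b : b \in L -> indecomposable Phi P0 h b.
  move=> bL; have [bPhi bN] := LN b bL; split.
    by apply/positiveP; rewrite inE /= bN divff ?gt_eqF // LU // rpred1.
  have ge1 c : c \in positive Phi P0 h -> N <= pairing c h.
    move=> /positiveP[_ + c0]; rewrite inE => /andP[_ /intrP[k kE]].
    have k0 : (0 < k)%R by rewrite -(ltr0z R) -kE divr_gt0.
    rewrite -[leLHS]mul1r -ler_pdivlMr // kE (ler_int R 1); lia.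
  move=> c d /ge1 c1 /ge1 d1 bE; move: bN; rewrite bE pairingDl; lra.
pose rho0 := rho Phi P0 h.
have rhoE v : v \in U -> N * pairing v rho0 = 2 * pairing v h.
  move=> vU; apply/eqP; rewrite -subr_eq0 -!pairingZr; apply/eqP.
  rewrite -mulN1r -pairingZr -pairingDr; move: v vU.
  apply: span_pairing => b bL; rewrite pairingDr !pairingZr.
  by rewrite (pairing_rho P0B P0reg (Lind b bL)) (LN b bL).2; ring.
have /intrP[k kE] := pairing_rho_int P0 h aPhi.
have aN2 : 2 * pairing a h = N.
  have := rhoE a aU; rewrite kE => aE.
  have k0 : (0 < k)%R by rewrite -(ltr0z R) -(pmulr_rgt0 _ N0) aE mulr_gt0.
  have k2 : (k < 2)%R.
    rewrite -(ltr_int R) -(ltr_pM2l N0) aE mulrC ltr_pM2r //; lra.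
  have k1 : k = 1 by lia.
  by rewrite -aE k1 mulr1.
pose Rs := [fset b in roots Phi | (b \in U) && (2 * pairing b h == N)].
pose L' := [fset b in roots Phi | (b \in U) && (pairing b h == N)].
pose sums := [fset b + c | b in Rs, c in Rs].
have RsP b : b \in Rs -> [/\ b \in roots Phi, b \in U & 2 * pairing b h = N].
  by rewrite !inE => /and3P[? ? /eqP].
have L'P b : b \in L' -> [/\ b \in roots Phi, b \in U & pairing b h = N].
  by rewrite !inE => /and3P[? ? /eqP].
have aRs : a \in Rs by rewrite !inE aPhi aU aN2 eqxx.
have same b c : b \in roots Phi -> c \in roots Phi -> b \in U -> c \in U ->
    b != c -> pairing b h = pairing c h -> ip b c <= 0.
  exact: same_level_obtuse.
have obtRs b c : b \in Rs -> c \in Rs -> b != c -> ip b c <= 0.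
  by move=> /RsP[? ? ?] /RsP[? ? ?] ?; apply: same => //; lra.
have cross b c : b \in L' `\` sums -> c \in Rs -> ip b c <= 0.
  rewrite in_fsetD => /andP[bsums bL'] cRs; have [bPhi bU bN] := L'P b bL'.
  have [cPhi cU cN] := RsP c cRs; rewrite leNgt; apply/negP => bc0.
  have bc : b != c by apply/eqP => bc; move: cN; rewrite -bc; lra.
  have bcRs : b - c \in Rs.
    rewrite !inE sub_root // rpredB // pairingBl bN /=; apply/eqP; lra.
  case/negP: bsums; apply/imfset2P; exists c => //; exists (b - c) => //.
  by rewrite addrC subrK.
have disj : [disjoint Rs & L' `\` sums]%fset.
  apply/fdisjointP => b /RsP[_ _ b2]; apply/negP; rewrite in_fsetD.
  by move=> /andP[_ /L'P[_ _ bN]]; lra.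
have fr : free (enum_fset Rs ++ enum_fset (L' `\` sums)).
  apply: (@obtuse_free _ _ Phi _ h).
  - rewrite cat_uniq !fset_uniq andbT /=; apply/hasPn => b bL'.
    by apply/negP => bR; move/fdisjointP: disj => /(_ b bR); rewrite bL'.
  - move=> b c; rewrite !mem_cat => /orP[bR|bL] /orP[cR|cL] bc.
    + exact: obtRs.
    + by rewrite ipC cross.
    + exact: cross.
    + move: bL cL; rewrite !in_fsetD => /andP[_ /L'P[? ? ?]] /andP[_ /L'P[? ? ?]].
      by apply: same => //; congruence.
  move=> b; rewrite mem_cat in_fsetD => /orP[/RsP[_ _]|/andP[_ /L'P[_ _]]]; lra.
have LL' : L `<=` L'.
  apply/fsubsetP => b bL; have [bPhi bN] := LN b bL.
  by rewrite !inE bPhi LU // bN eqxx.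
have card1 : (#|` Rs| <= #|` L' `&` sums|)%N.
  have : (#|` Rs| + #|` L' `\` sums| <= #|` L'|)%N.
    rewrite -size_cat -(eqP fr); apply: leq_trans (fsubset_leq_card LL').
    apply: leq_trans (dim_span L); apply: dimvS; apply/span_subvP => b.
    rewrite mem_cat in_fsetD => /orP[/RsP[]//|/andP[_ /L'P[]//]].
  rewrite -(cardfsID sums L') addnC [leqRHS]addnC; by rewrite leq_add2l.
have card2 : (#|` L' `&` sums| < #|` Rs|)%N.
  set A := L' `&` sums.
  have AP b : b \in A -> [/\ b \in roots Phi & b \in sums].
    by rewrite in_fsetI => /andP[/L'P[]].
  pose w b := (Num.sqrt (ip b b))^-1.
  have w0 b : b \in roots Phi -> 0 < w b.
    by move=> bPhi; rewrite invr_gt0 sqrtr_gt0 ip_gt0 // (root_nz bPhi).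
  have ww b : b \in roots Phi -> w b * w b * ip b b = 1.
    move=> bPhi; have bb := ip_gt0 Phi (root_nz bPhi); rewrite -invfM -expr2.
    by rewrite sqr_sqrtr ?ltW // mulVf // gt_eqF.
  (* the sum of the normalised roots, whose square length is estimated *)
  have E0 : \sum_(b <- Rs) w b *: b != 0.
    apply/eqP => /(congr1 (fun v => pairing v h)); rewrite pairing0l pairing_suml.
    rewrite (big_rem a) //= pairingZl => /eqP; rewrite gt_eqF // ltr_pwDl //.
      by rewrite mulr_gt0 // w0.
    rewrite big_seq; apply: sumr_ge0 => b /mem_rem /RsP[bPhi _ bN].
    by rewrite pairingZl mulr_ge0 ?ltW ?w0 //; lra.
  have double b : b \in roots Phi -> b + b \notin roots Phi.
    move=> bPhi; rewrite -mulr2n -scaler_nat; apply/negP => /(roots_reduced bPhi).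
    by case=> /eqP; lra.
  pose m b c : R := \sum_(x <- A) (x == b + c)%:R.
  have term b c : b \in Rs -> c \in Rs ->
      w b * w c * ip b c <= (b == c)%:R - (1 / 2) * m b c.
    move=> bR cR; have [bPhi bU bN] := RsP b bR; have [cPhi cU cN] := RsP c cR.
    have mE : m b c = (b + c \in A)%:R.
      have [bcA|bcA] := boolP (b + c \in A).
        rewrite /m (big_rem (b + c)) //= eqxx big_seq big1 ?addr0 // => x.
        by rewrite mem_rem_uniq ?fset_uniq // inE => /andP[/negbTE ->].
      rewrite /m big_seq big1 // => x xA; case: eqP => // xE.
      by rewrite xE (negbTE bcA) in xA.
    rewrite mE; have [<-|bc] := eqVneq b c.
      rewrite ww // (_ : _ \in A = false) ?mulr0 ?subr0 //.
      by apply/negP => /AP[bbPhi _]; have := double b bPhi; rewrite bbPhi.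
    have bc0 := obtRs b c bR cR bc.
    have [/AP[bcPhi _]|_] := boolP (b + c \in A); last first.
      rewrite mulr0 subr0 mulr_ge0_le0 // mulr_ge0 // ltW // w0 //.
    rewrite mulr1 sub0r ip_obtuse_roots // lt_neqAle bc0 andbT.
    apply/eqP => ip0; have bcU : c - b \in U by exact: rpredB.
    have : c - b \in roots Phi.
      have := refl_root bPhi bcPhi; rewrite /refl pairingDl (pairing_coroot bPhi).
      have -> : pairing c (coroot b) = 0.
        apply: (mulfI (lt0r_neq0 (ip_gt0 Phi (root_nz bPhi)))).
        by rewrite -ip_root // ipC ip0 !mulr0.
      by rewrite addr0 scaler_nat mulr2n opprD addrACA subrr add0r.
    by move=> /hU /(_ bcU); rewrite pairingBl => /eqP; lra.
  have : \sum_(b <- Rs) \sum_(c <- Rs) w b * w c * ip b c <=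
      #|` Rs|%:R - #|` A|%:R.
    apply: (@le_trans _ _
      (\sum_(b <- Rs) \sum_(c <- Rs) ((b == c)%:R - (1 / 2) * m b c))).
      rewrite !big_seq; apply: ler_sum => b bR; rewrite !big_seq.
      by apply: ler_sum => c cR; exact: term.
    have -> : \sum_(b <- Rs) \sum_(c <- Rs) ((b == c)%:R - (1 / 2) * m b c) =
        #|` Rs|%:R -
        (1 / 2) * \sum_(x <- A) \sum_(b <- Rs) \sum_(c <- Rs) (x == b + c)%:R.
      rewrite exchange_big /=.
      under [X in _ - _ * X]eq_bigr do rewrite exchange_big /=.
      rewrite [in RHS]exchange_big /= mulr_sumr.
      rewrite -[in RHS](sum1_size (enum_fset Rs)) natr_sum -sumrB.
      rewrite !big_seq; apply: eq_bigr => c cR.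
      rewrite sumrB -mulr_sumr; congr (_ - _ * _).
        rewrite (big_rem c) //= eqxx big_seq big1 ?addr0 // => b.
        by rewrite mem_rem_uniq ?fset_uniq // inE => /andP[/negbTE ->].
      by rewrite [RHS]exchange_big.
    rewrite lerD2l lerN2 -(sum1_size (enum_fset A)) natr_sum mulr_sumr !big_seq.
    apply: ler_sum => x /AP[xPhi /imfset2P[b /= bR [c /= cR xE]]].
    pose F b' : R := \sum_(c' <- Rs) (x == b' + c')%:R.
    have F0 b' : 0 <= F b' by apply: sumr_ge0 => c' _; exact: ler0n.
    have bc : b != c.
      apply: contraTneq xPhi => bc; rewrite xE bc; apply: double.
      by case: (RsP c cR).
    (* the ordered pairs (b, c) and (c, b) both have sum [x] *)
    have Fb : 1 <= F b.
      have := @le_sum1 _ Rs (fun c' => (x == b + c')%:R) c.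
      by rewrite -xE eqxx; apply=> // c'; exact: ler0n.
    have Fc : 1 <= F c.
      have := @le_sum1 _ Rs (fun c' => (x == c + c')%:R) b.
      by rewrite [c + b]addrC -xE eqxx; apply=> // c'; exact: ler0n.
    have := le_sum2 F0 bR cR bc; rewrite -/(F _); lra.
  have -> : \sum_(b <- Rs) \sum_(c <- Rs) w b * w c * ip b c =
      ip (\sum_(b <- Rs) w b *: b) (\sum_(b <- Rs) w b *: b).
    rewrite ip_suml; apply: eq_bigr => b _; rewrite ip_sumr; apply: eq_bigr => c _.
    by rewrite ipZl ipZr mulrA.
  move=> /(lt_le_trans (ip_gt0 Phi E0)); rewrite subr_gt0 ltr_nat.
  by [].
lia.
Qed.

End Levels.

Lemma mem_fsep (T : choiceType) (A : {fset T}) (p : pred T) a :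
  (a \in [fset x in A | p x]) = (a \in A) && p a.
Proof. by rewrite !inE. Qed.

(** * Subsystems of rank two *)

Section RankTwo.

Local Notation roots := Defs.roots.
Variables (R : realType) (n : nat) (Phi : root_system R n) (h : 'cV[R]_n).
Implicit Types (a b c d e g u v : 'rV[R]_n).
Local Notation ip := (ip Phi).
Local Notation coroot := (coroot Phi).
Hypothesis h_reg : forall a, a \in roots Phi -> pairing a h != 0.

Section Plane.

Variable U : {vspace 'rV[R]_n}.
Hypothesis dimU : (\dim U <= 2)%N.

Let P : {pred 'rV[R]_n} := [pred v | v \in U].
Local Notation pos := (positive Phi P h).
Local Notation t a := (pairing a (rho Phi P h)).

Let PB a b : a \in P -> b \in P -> a - b \in P.
Proof. exact: rpredB. Qed.

Let P_reg a : a \in roots Phi -> a \in P -> pairing a h != 0.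
Proof. by move=> aPhi _; exact: h_reg. Qed.

Lemma plane_indecomposables d d1 d2 :
  indecomposable Phi P h d -> indecomposable Phi P h d1 ->
  indecomposable Phi P h d2 -> d1 != d -> d2 != d -> d1 = d2.
Proof.
move=> id0 id1 id2 d1d d2d; apply/eqP/negPn/negP => d12.
have Ps b : b \in [:: d; d1; d2] -> indecomposable Phi P h b.
  by rewrite !inE => /or3P[] /eqP->.
have fr : free [:: d; d1; d2].
  apply: (@obtuse_free _ _ Phi _ h).
  - by rewrite /= !inE !negb_or eq_sym d1d eq_sym d2d d12.
  - move=> b c /Ps ib /Ps ic bc; exact: (indecomposable_obtuse PB P_reg).
  by move=> b /Ps[/positiveP[]].
have : (\dim <<[:: d; d1; d2]>> <= \dim U)%N.
  by apply/dimvS/span_subvP => b /Ps[/positiveP[]].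
by rewrite (eqP fr) /=; lia.
Qed.

Lemma rho_reg a : a \in roots Phi -> a \in U -> t a != 0.
Proof.
move=> aPhi aU; have [] := positiveVopp PB P_reg aPhi aU.
  by move=> /(rho_positive PB P_reg)[k ->]; rewrite mulf_neq0 ?pnatr_eq0.
move=> /(rho_positive PB P_reg)[k]; rewrite pairingNl => kE.
by rewrite -oppr_eq0 kE mulf_neq0 ?pnatr_eq0.
Qed.

(** Two roots of the same level span the plane, so by [level_gap] there would
    be no indecomposable root below them. *)
Lemma plane_level_unique c1 c2 (k : nat) :
  c1 \in pos -> c2 \in pos -> t c1 = 2 * k.+2%:R -> t c2 = 2 * k.+2%:R -> c1 = c2.
Proof.
move=> c1pos c2pos c1k c2k; apply/eqP/negPn/negP => c12.
have /positiveP[c1Phi c1U _] := c1pos; have /positiveP[c2Phi c2U _] := c2pos.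
have t4 : (2 : R) < 2 * k.+2%:R.
  by rewrite -[ltLHS]mulr1 ltr_pM2l // ltr1n.
have c1nind : ~ indecomposable Phi P h c1.
  by move=> /(pairing_rho PB P_reg); rewrite c1k => E; rewrite E ltxx in t4.
have [d dind _] := exists_indecomposable_sub PB P_reg c1pos c1nind.
have [/positiveP[dPhi dU _] _] := dind.
pose L := [fset c1; c2].
have LU b : b \in L -> [/\ b \in roots Phi, b \in U & t b = 2 * k.+2%:R].
  by rewrite !inE => /orP[] /eqP->.
have LE : <<L>>%VS = U.
  have fr : free (enum_fset L).
    apply: (@obtuse_free _ _ Phi _ (rho Phi P h)); first exact: fset_uniq.
      move=> b c /LU[bPhi bU bk] /LU[cPhi cU ck] bc.
      by apply: (same_level_obtuse rho_reg) => //; rewrite bk ck.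
    by move=> b /LU[_ _ ->]; rewrite mulr_gt0 ?ltr0n.
  apply/eqP; rewrite eqEdim (eqP fr) cardfs2 c12 dimU andbT.
  by apply/span_subvP => b /LU[].
suff : 2 * k.+2%:R <= t d by rewrite (pairing_rho PB P_reg dind) leNgt t4.
apply: (@level_gap _ _ Phi _ L) => //; rewrite ?LE //.
- by rewrite mulr_gt0 ?ltr0n.
- by move=> b /LU[].
- exact: rho_reg.
by rewrite (pairing_rho PB P_reg dind).
Qed.

Definition down_closed (A J : {fset 'rV[R]_n}) : Prop :=
  forall a b, a \in A -> b \in A -> a + b \in J -> a \in J.

Lemma summand_below c d e : d \in pos -> e \in pos -> c = d + e ->
  pairing d h < pairing c h /\
  forall J, down_closed pos J -> c \in J -> d \in J.
Proof.
move=> dpos epos cE; have /positiveP[_ _ e0] := epos; split.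
  by rewrite cE pairingDl ltrDl.
by move=> J Jdown cJ; apply: (Jdown d e); rewrite -?cE.
Qed.

Lemma plane_split (k : nat) c : c \in pos -> t c = 2 * k.+2%:R ->
  exists d e, [/\ d \in pos, indecomposable Phi P h e, c = d + e &
                  t d = 2 * k.+1%:R].
Proof.
move=> cpos ck; have cnind : ~ indecomposable Phi P h c.
  move=> /(pairing_rho PB P_reg)/eqP; rewrite ck -[X in _ == X]mulr1.
  by rewrite (inj_eq (mulfI _)) ?pnatr_eq0 // pnatr_eq1.
have [e eind dpos] := exists_indecomposable_sub PB P_reg cpos cnind.
exists (c - e), e; split=> //; first by rewrite subrK.
by rewrite pairingBl ck (pairing_rho PB P_reg eind) -[k.+2%:R]natr1; ring.
Qed.

(** In a subsystem of rank 2 the positive roots are the two indecomposable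
    ones followed by a chain in which consecutive roots differ by an
    indecomposable one.  So any linear functional positive on positive roots
    orders them in the same way above level one, and the number of positive
    roots below a root of level [k + 2] is [k + 2]. *)
Lemma plane_chain (k : nat) c :
  c \in pos -> t c = 2 * k.+2%:R ->
  [/\ forall g, g \in pos -> t g < t c -> pairing g h < pairing c h,
      forall J, down_closed pos J -> c \in J ->
        forall g, g \in pos -> t g < t c -> g \in J
    & #|` [fset g in pos | t g < t c]| = k.+2].
Proof.
elim: k c => [|k IH] c cpos ck.
  have [d [e [dpos eind cE]]] := plane_split cpos ck; rewrite mulr1 => dt.
  have [epos _] := eind; have et := pairing_rho PB P_reg eind.
  have [hd Jd] := summand_below dpos epos cE.
  have [he Je] := summand_below epos dpos (etrans cE (addrC _ _)).
  have dind := rho2_indecomposable PB P_reg dpos dt.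
  have de : d != e.
    apply/eqP => de; have cE2 : c = 2 *: e by rewrite cE de scaler_nat mulr2n.
    by have /eqP := positive_double epos cpos cE2; rewrite pnatr_eq1.
  have low g : g \in pos -> t g < t c -> g = d \/ g = e.
    move=> gpos; rewrite ck; have [m mE] := rho_positive PB P_reg gpos.
    rewrite mE ltr_pM2l // ltr_nat ltnS ltnS leqn0 => /eqP m0.
    have gind : indecomposable Phi P h g.
      by apply: (rho2_indecomposable PB P_reg gpos); rewrite mE m0 mulr1.
    have [->|gd] := eqVneq g d; [by left|right].
    by apply: (plane_indecomposables dind); rewrite // eq_sym.
  split.
  - by move=> g gpos /(low g gpos)[]->.
  - by move=> J Jdown cJ g gpos /(low g gpos)[]->; [exact: Jd|exact: Je].
  have -> : [fset g in pos | t g < t c] = [fset d; e].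
    apply/fsetP => g; rewrite in_fset2 mem_fsep; apply/andP/orP.
      by move=> [gpos /(low g gpos)[]->]; rewrite eqxx; [left|right].
    have t24 : (2 : R) < t c by rewrite ck -[ltLHS]mulr1 ltr_pM2l // ltr1n.
    by move=> [] /eqP->; rewrite ?dt ?et t24.
  by rewrite cardfs2 de.
have [d [e [dpos eind cE dt]]] := plane_split cpos ck.
have [epos _] := eind; have [hd Jd] := summand_below dpos epos cE.
have [IH1 IH2 IH3] := IH d dpos dt.
have dc : t d < t c by rewrite dt ck ltr_pM2l // ltr_nat.
have low g : g \in pos -> t g < t c -> t g < t d \/ g = d.
  move=> gpos; rewrite ck dt; have [m mE] := rho_positive PB P_reg gpos.
  rewrite mE !ltr_pM2l // !ltr_nat ltnS leq_eqVlt => /orP[/eqP mk|]; last by left.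
  by right; apply: (plane_level_unique gpos dpos _ dt); rewrite mE mk.
split.
- move=> g gpos /(low g gpos)[gd|->//]; exact: lt_trans (IH1 g gpos gd) hd.
- move=> J Jdown cJ g gpos /(low g gpos)[gd|->]; last exact: Jd.
  by apply: IH2 => //; exact: Jd.
have -> : [fset g in pos | t g < t c] = d |` [fset g in pos | t g < t d].
  apply/fsetP => g; have memE x := mem_fsep pos (fun g => t g < x) g.
  rewrite in_fset1U !memE; apply/andP/orP.
    by move=> [gpos /(low g gpos)[gd|->]]; rewrite ?eqxx ?gpos ?gd; [right|left].
  by move=> [/eqP->|/andP[gpos gd]]; [|split=> //; exact: lt_trans gd dc].
by rewrite cardfsU1 IH3 mem_fsep ltxx andbF.
Qed.

End Plane.

End RankTwo.

(** * The degree of the restriction polynomial *)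

Section RestrictionCount.

Local Notation roots := Defs.roots.
Variables (R : realType) (n : nat) (Phi : root_system R n) (h : 'cV[R]_n).
Implicit Types (a b c d e g u v : 'rV[R]_n).
Hypothesis h_reg : forall a, a \in roots Phi -> pairing a h != 0.

Local Notation all_pos := (positive Phi predT h).
Variables (J : {fset 'rV[R]_n}) (b : 'rV[R]_n).
Hypothesis J_pos : J `<=` all_pos.
Hypothesis J_down : down_closed all_pos J.
Hypothesis bJ : b \in J.

Let below := [fset a in J | pairing a h < pairing b h].
Let in_plane (U : {vspace 'rV[R]_n}) : {pred 'rV[R]_n} := [pred v | v \in U].
Local Notation pos U := (positive Phi (in_plane U) h).

Let pos_sub U a : a \in pos U -> a \in all_pos.
Proof. by move=> /positiveP[? _ ?]; apply/positiveP. Qed.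

Let b_pos : b \in all_pos.
Proof. exact: (fsubsetP J_pos). Qed.

Lemma eq_plane_positive a c :
  a \in all_pos -> c \in all_pos -> a != b -> c != b ->
  (plane b c == plane b a) = (c \in plane b a).
Proof.
move=> apos cpos ab cb; apply/eqP/idP => [<-|]; first exact: mem_plane_r.
move=> /planeP[k [e cE]]; apply: (eq_plane _ cE).
apply: contraNneq cb => k0.
have cE' : c = e *: b by rewrite cE k0 scale0r add0r.
by rewrite cE' (positive_double b_pos cpos cE') scale1r.
Qed.

Lemma dim_plane a : (\dim (plane b a) <= 2)%N.
Proof.
apply: leq_trans (dimv_add_leqif _ _).1 _; rewrite !dim_vline.
by case: (b != 0); case: (a != 0).
Qed.

(** If [b] is indecomposable in the plane, at most the other indecomposable
    root lies below it and both sides vanish; otherwise [plane_chain] counts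
    the roots below. *)
Lemma plane_count a : a \in all_pos -> a != b ->
  2 * #|` [fset c in below | plane b c == plane b a]|.-1%:R =
  pairing b (rho Phi (in_plane (plane b a)) h) - 2.
Proof.
move=> apos ab; set U := plane b a; set S := imfset _ _ _.
have dimU : (\dim U <= 2)%N by exact: dim_plane.
have PB c d : c \in in_plane U -> d \in in_plane U -> c - d \in in_plane U.
  exact: rpredB.
have Preg c : c \in roots Phi -> c \in in_plane U -> pairing c h != 0.
  by move=> cPhi _; exact: h_reg.
have /positiveP[bPhi _ b0] := b_pos.
have bpos : b \in pos U by apply/positiveP; rewrite inE /= mem_plane_l.
have SP c : reflect [/\ c \in J, pairing c h < pairing b h & c \in pos U] (c \in S).
  have -> : (c \in S) = [&& c \in J, pairing c h < pairing b h & plane b c == U].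
    by rewrite !inE /= andbA.
  apply: (iffP and3P) => [[cJ cb]|[cJ cb cpos]].
    have cpos := fsubsetP J_pos c cJ; have cNb : c != b.
      by apply: contraTneq cb => ->; rewrite ltxx.
    rewrite eq_plane_positive // => cU; split=> //; apply/positiveP.
    by have /positiveP[? _ ?] := cpos.
  rewrite cJ cb eq_plane_positive ?(pos_sub cpos) //; last first.
    by apply: contraTneq cb => ->; rewrite ltxx.
  by split=> //; have /positiveP[_ ? _] := cpos.
have J_downU : down_closed (pos U) J.
  by move=> c d /pos_sub cpos /pos_sub dpos; exact: J_down.
have [k kE] := rho_positive PB Preg bpos; rewrite kE.
case: k => [|k] in kE *.
  have bind : indecomposable Phi (in_plane U) h b.
    by apply: (rho2_indecomposable PB Preg bpos); rewrite kE mulr1.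
  have Sind c : c \in S -> indecomposable Phi (in_plane U) h c /\ c != b.
    move=> /SP[_ cb cpos]; split; last by apply: contraTneq cb => ->; rewrite ltxx.
    have [l lE] := rho_positive PB Preg cpos.
    case: l => [|l] in lE.
      by apply: (rho2_indecomposable PB Preg cpos); rewrite lE mulr1.
    have [/(_ b bpos) + _ _] := plane_chain h_reg dimU cpos lE.
    by rewrite lE kE ltr_pM2l // ltr_nat => /(_ isT) bc; rewrite ltNge ltW in cb.
  have S1 : (#|` S| <= 1)%N.
    have [->|/fset0Pn[c cS]] := eqVneq S fset0; first by rewrite cardfs0.
    rewrite -[leqRHS](cardfs1 c); apply/fsubset_leq_card/fsubsetP => d dS.
    have [cind cb] := Sind c cS; have [dind db] := Sind d dS.
    by rewrite in_fset1; apply/eqP/(plane_indecomposables h_reg dimU bind).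
  have -> : #|` S|.-1 = 0%N by lia.
  by rewrite mulr1 subrr mulr0.
have [chain_h chain_J card] := plane_chain h_reg dimU bpos kE.
have -> : S = [fset g in pos U |
    pairing g (rho Phi (in_plane U) h) < pairing b (rho Phi (in_plane U) h)].
  apply/fsetP => c; rewrite mem_fsep; apply/SP/andP => [[cJ cb cpos]|[cpos cb]].
    split=> //; rewrite ltNge; apply/negP => bc.
    have [l lE] := rho_positive PB Preg cpos.
    rewrite lE kE ler_pM2l // ler_nat in bc.
    case: l => [//|l] in lE bc *.
    have [kl|kl] := eqVneq k l.
      move: cb; rewrite (plane_level_unique h_reg dimU cpos bpos lE) ?ltxx //.
      by rewrite kE kl.
    have [/(_ b bpos) + _ _] := plane_chain h_reg dimU cpos lE.
    rewrite lE kE ltr_pM2l // ltr_nat => bc_h.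
    have bc' : pairing b h < pairing c h by apply: bc_h; lia.
    by rewrite ltNge ltW in cb.
  by split=> //; [exact: (chain_J J)|exact: chain_h].
by rewrite card /= -[k.+2%:R]natr1; ring.
Qed.

(** The left-hand side of the hypothesis is a sum of Cartan numbers over all
    positive roots.  It splits into 2, from [b] itself, and one sum for each
    plane through [b], which [plane_count] evaluates. *)
Theorem restriction_count (m : nat) :
  pairing b (rho Phi predT h) = 2 * m.+1%:R ->
  (\sum_(X <- [fset plane b a | a in below])
     #|` [fset a in below | plane b a == X]|.-1)%N = m.
Proof.
move=> bm; pose others := all_pos `\ b.
have below_others : below `<=` others.
  apply/fsubsetP => a; rewrite in_fsetD1 inE /= => /andP[aJ ab].
  rewrite (fsubsetP J_pos) // andbT; apply: contraTneq ab => ->.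
  by rewrite ltxx.
rewrite (@big_fset_incl _ _ _ _ _ [fset plane b a | a in others]); first last.
- move=> X _ XN; rewrite (_ : [fset a in below | _] = fset0) ?cardfs0 //.
  apply/fsetP => a; rewrite !inE /=; apply/negP => /andP[ab /eqP aX].
  by case/negP: XN; apply/imfsetP; exists a => //; rewrite inE.
- apply/fsubsetP => X /imfsetP[a /= ab ->]; apply/imfsetP; exists a => //.
  exact: (fsubsetP below_others).
have two : 2 != 0 :> R by rewrite pnatr_eq0.
apply/eqP; rewrite -(eqr_nat R) -(inj_eq (mulfI two)) natr_sum mulr_sumr.
have -> : 2 * m%:R = pairing b (rho Phi predT h) - 2 by rewrite bm -natr1; ring.
have /positiveP[bPhi _ b0] := b_pos.
rewrite /rho pairing_sumr (big_fsetD1 b) //= (pairing_coroot bPhi).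
rewrite addrAC subrr add0r.
rewrite (partition_big_imfset _ (plane b)) /=; apply/eqP.
rewrite !big_seq; apply: eq_bigr => X /imfsetP[a /=].
rewrite in_fsetD1 => /andP[ab apos] ->; rewrite plane_count // /rho pairing_sumr.
have bpos : b \in pos (plane b a) by apply/positiveP; rewrite inE /= mem_plane_l.
rewrite (big_fsetD1 b) //= (pairing_coroot bPhi) addrAC subrr add0r.
apply/esym; rewrite -big_filter; apply/perm_big/uniq_perm;
  rewrite ?filter_uniq ?fset_uniq //.
move=> c; rewrite mem_filter in_fsetD1 [in RHS]in_fsetD1.
have [->|cb] := eqVneq c b; first by rewrite andbF.
rewrite /=; apply/andP/idP => [[cX cpos]|cpos].
  have /positiveP[cPhi _ c0] := cpos; apply/positiveP; split=> //.
  by rewrite inE -eq_plane_positive.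
split; last exact: pos_sub cpos.
by rewrite eq_plane_positive ?(pos_sub cpos) //; have /positiveP[_ ? _] := cpos.
Qed.

End RestrictionCount.

(** * Derivation modules of arrangements *)

Section DerivationModule.

Variables (R : realType) (n : nat).
Implicit Types (a b : 'rV[R]_n) (x : 'cV[R]_n) (J : {fset 'rV[R]_n}).
Implicit Types (p : 'rV[{mpoly R[n]}]_n) (f g : {mpoly R[n]}).
Local Notation mdvd := (@in_principal_ideal R n).

Lemma mem_hyperplane a x : (x \in hyperplane a) = (pairing a x == 0).
Proof.
rewrite memv_ker lfunE /=; apply/eqP/eqP => [ax|ax].
  by rewrite /pairing ax mxE.
by rewrite [LHS]mx11_scalar -/(pairing a x) ax raddf0.
Qed.

Lemma ker_sub_proportional a b : a != 0 ->
  (forall x, pairing a x = 0 -> pairing b x = 0) -> exists k, b = k *: a.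
Proof.
move=> a0 ab; exists (pairing b (dual_vec a)).
apply/rowP => i; rewrite mxE; pose x : 'cV[R]_n := delta_mx i 0.
have xE c : pairing c x = c 0 i by rewrite /pairing -colE mxE.
have xdE c : pairing c (x + (- pairing a x) *: dual_vec a) =
    pairing c x - pairing a x * pairing c (dual_vec a).
  by rewrite pairingDr (pairingZr (- _)) mulNr.
have := ab (x + (- pairing a x) *: dual_vec a).
rewrite !xdE (pairing_dual_vec a0) mulr1 subrr !xE => /(_ erefl) /eqP.
by rewrite subr_eq0 mulrC => /eqP.
Qed.

Lemma form_of_hyperplane a : a != 0 ->
  exists2 k, k != 0 & form_of (hyperplane a) = k *: a.
Proof.
move=> a0; rewrite /form_of; set b := xget _ _.
have bH : hyperplane b = hyperplane a.
  by rewrite /b; case: xgetP => [c _ //|/(_ a)]; case.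
have same x : (pairing b x == 0) = (pairing a x == 0).
  by rewrite -!mem_hyperplane bH.
have [|k kE] := @ker_sub_proportional a b a0.
  by move=> x /eqP; rewrite -same => /eqP.
exists k => //; apply/eqP => k0.
have : pairing a (dual_vec a) == 0 by rewrite -same kE k0 scale0r pairing0l.
by rewrite pairing_dual_vec ?oner_eq0 //.
Qed.

Definition nonproportional J : Prop :=
  {in J, forall a, a != 0} /\
  {in J &, forall a b (k : R), a = k *: b -> a = b}.

Lemma defining_polyE J : nonproportional J ->
  exists2 k, k != 0 &
    defining_poly (root_arrangement J) = k *: \prod_(a <- J) linear_form a.
Proof.
move=> [J0 Jprop]; rewrite /defining_poly /root_arrangement big_imfset /=; last first.
  move=> a b aJ bJ abH; have [|k bE] := @ker_sub_proportional a b (J0 a aJ).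
    by move=> x /eqP; rewrite -mem_hyperplane abH mem_hyperplane => /eqP.
  by apply/esym/(Jprop _ _ bJ aJ k).
have : {subset enum_fset J <= J} by [].
elim: (enum_fset J) => [|a s IH] sJ.
  by exists 1; rewrite ?oner_eq0 // !big_nil scale1r.
have [|k k0 kE] := IH; first by move=> b bs; apply: sJ; rewrite inE bs orbT.
have [l l0 lE] := form_of_hyperplane (J0 a (sJ a (mem_head _ _))).
exists (l * k); first by rewrite mulf_neq0.
by rewrite !big_cons kE lE linearZ /= -scalerAl -scalerAr scalerA.
Qed.

Definition derivation_of p f : {mpoly R[n]} := \sum_j p 0 j * f^`M(j).

Lemma derivation_ofP p : is_derivation (derivation_of p).
Proof.
split=> [k f g|f g]; rewrite /derivation_of.
  rewrite scaler_sumr -big_split; apply: eq_bigr => j _ /=.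
  by rewrite linearP /= mulrDr scalerAr.
rewrite mulr_suml mulr_sumr -big_split; apply: eq_bigr => j _ /=.
by rewrite mderivM; ring.
Qed.

Lemma derivation_ofX p j : derivation_of p 'X_j = p 0 j.
Proof.
have jj : (U_(j) - U_(j))%MM = 0%MM by apply/mnmP => i; rewrite !mnmE subnn.
rewrite /derivation_of (bigD1 j) //= big1 => [|i ij]; rewrite mderivX mnm1E.
  by rewrite eqxx jj scale1r mpolyX0 mulr1 addr0.
by rewrite eq_sym (negbTE ij) scale0r mulr0.
Qed.

Lemma derivation_sum theta (I : Type) (r : seq I) (k : I -> R)
    (F : I -> {mpoly R[n]}) :
  is_derivation theta ->
  theta (\sum_(i <- r) k i *: F i) = \sum_(i <- r) k i *: theta (F i).
Proof.
move=> [lin _]; elim: r => [|i r IH].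
  by have := lin (-1) 0 0; rewrite !big_nil addr0 scaler0 scaleN1r addNr.
by rewrite !big_cons lin IH.
Qed.

Lemma derivation_of_linear_form p a : derivation_of p (linear_form a) = act p a.
Proof.
rewrite /linear_form (derivation_sum _ _ _ (derivation_ofP p)).
by apply: eq_bigr => j _; rewrite derivation_ofX.
Qed.

Lemma derivation_ext (theta eta : {mpoly R[n]} -> {mpoly R[n]}) :
  is_derivation theta -> is_derivation eta ->
  (forall j, theta 'X_j = eta 'X_j) -> theta =1 eta.
Proof.
move=> tder eder X; have [_ tM] := tder; have [_ eM] := eder.
have one (d : {mpoly R[n]} -> {mpoly R[n]}) :
    (forall f g, d (f * g) = d f * g + f * d g) -> d 1 = 0.
  by move=> /(_ 1 1)/eqP; rewrite !mulr1 mul1r -subr_eq subrr eq_sym => /eqP.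
have EM f g : theta f = eta f -> theta g = eta g -> theta (f * g) = eta (f * g).
  by move=> fE gE; rewrite tM eM fE gE.
have E1 : theta 1 = eta 1 by rewrite (one _ tM) (one _ eM).
have EXm m : theta 'X_[m] = eta 'X_[m].
  rewrite mpolyXE_id; apply: (big_ind (fun f => theta f = eta f)) => // i _.
  by elim: (m i) => [|k IH]; rewrite ?expr0 // exprS; exact: EM.
move=> f; rewrite [f]mpolyE !derivation_sum //.
by apply: eq_bigr => m _; rewrite EXm.
Qed.

Lemma derivationE theta f : is_derivation theta ->
  theta f = derivation_of (\row_j theta 'X_j) f.
Proof.
move=> der; apply: derivation_ext => //; first exact: derivation_ofP.
by move=> j; rewrite derivation_ofX mxE.
Qed.

(** The defining polynomial is a product of pairwise non-associated primes;
    by the Leibniz rule a derivation preserves its ideal exactly when it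
    preserves the ideal of each factor. *)
Lemma derivation_moduleP J p : nonproportional J ->
  in_derivation_module (root_arrangement J) (derivation_of p) <->
  log_derivation J p.
Proof.
move=> Jnp; have [J0 Jprop] := Jnp; have [k k0 kE] := defining_polyE Jnp.
have [_ dM] := derivation_ofP p.
set Q := \prod_(a <- J) _ in kE.
have idealE f :
    in_principal_ideal (defining_poly (root_arrangement J)) f <-> mdvd Q f.
  rewrite kE; split=> -[g ->].
    by exists (k *: g); rewrite -scalerAl -scalerAr.
  by exists (k^-1 *: g); rewrite -scalerAl -scalerAr scalerA mulVf // scale1r.
split=> [[_ pres] a aJ|plog]; last first.
  split=> [|f /idealE[g ->]]; first exact: derivation_ofP.
  apply/idealE; rewrite dM; apply: mdvdD; first exact/mdvdM/mdvd_refl.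
  apply: mdvdM; rewrite /Q.
  have : {subset enum_fset J <= J} by [].
  elim: (enum_fset J) => [|a s IH] sJ.
    by rewrite big_nil; exists (derivation_of p 1); rewrite mulr1.
  rewrite !big_cons dM.
  have [|u ->] := IH; first by move=> b bs; apply: sJ; rewrite inE bs orbT.
  have [|v vE] := plog a; first by apply: sJ; rewrite mem_head.
  by exists (v + u); rewrite derivation_of_linear_form vE; ring.
have /idealE dQ := pres Q (proj2 (idealE Q) (mdvd_refl Q)).
pose Qa := \prod_(b <- J `\ a) linear_form b.
have QE : Q = linear_form a * Qa by rewrite /Q (big_fsetD1 a).
have : mdvd (linear_form a) (act p a * Qa).
  have -> : act p a * Qa = derivation_of p Q - linear_form a * derivation_of p Qa.
    by rewrite QE dM derivation_of_linear_form addrK.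
  apply: mdvdB; last exact/mdvdMr/mdvd_refl.
  by apply: mdvd_trans dQ; rewrite QE; exact/mdvdMr/mdvd_refl.
case/linear_form_prime => // /linear_form_prime_prod[b].
rewrite in_fsetD1 => /andP[ba bJ] /(linear_form_mdvd (J0 a aJ))[l bE].
by rewrite (Jprop _ _ bJ aJ l bE) eqxx in ba.
Qed.

Lemma graded_basis_derivations J M e : nonproportional J -> graded_basis J M e ->
  is_derivation_basis (root_arrangement J) (fun i => derivation_of (row i M)).
Proof.
move=> Jnp Mb; have [Mlog Mspan _] := Mb; split.
- by move=> i; apply/(derivation_moduleP _ Jnp).
- move=> theta [der pres].
  have thetaE : theta = derivation_of (\row_j theta 'X_j).
    by apply/funext => f; exact: derivationE.
  have /(derivation_moduleP _ Jnp)/Mspan[c cE] :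
      in_derivation_module (root_arrangement J) (derivation_of (\row_j theta 'X_j)).
    by rewrite -thetaE.
  exists (c 0) => f; rewrite thetaE cE /derivation_of.
  under [RHS]eq_bigr do rewrite mulr_sumr.
  rewrite [RHS]exchange_big; apply: eq_bigr => j _ /=.
  by rewrite mxE mulr_suml; apply: eq_bigr => i _; rewrite mxE mulrA.
move=> c c0; have [P PM] := graded_basis_unit Mb; set Q := \prod_(a <- J) _ in PM.
have Q0 : Q != 0.
  rewrite prodf_seq_neq0; apply/allP => a aJ /=.
  by rewrite linear_form_eq0; case: Jnp => + _; exact.
have cM : \row_i c i *m M = 0.
  apply/rowP => j; rewrite !mxE -[RHS](c0 'X_j).
  by apply: eq_bigr => i _; rewrite derivation_ofX !mxE.
have detM : \det M != 0.
  apply: contraTneq (oner_neq0 {mpoly R[n]}) => dM0.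
  have := congr1 determinant PM; rewrite det_mulmx dM0 mulr0 det_scalar.
  by move/esym/eqP; rewrite expf_eq0 (negbTE Q0) andbF.
move=> i; have := congr1 (mulmx^~ (\adj M)) cM.
rewrite -mulmxA mul_mx_adj mul0mx mul_mx_scalar => /rowP/(_ i)/eqP.
by rewrite !mxE mulf_eq0 (negbTE detM) => /eqP.
Qed.

Lemma graded_basis_free_exponents J M e (E : seq nat) :
  nonproportional J -> graded_basis J M e -> E = codom e ->
  is_free (root_arrangement J) /\ has_exponents (root_arrangement J) E.
Proof.
move=> Jnp Mb Ee; have basis := graded_basis_derivations Jnp Mb.
split; first by exists n, (fun i => derivation_of (row i M)).
have sE : size E = n by rewrite Ee size_codom card_ord.
have nthE (i : 'I_n) : nth 0%N E i = e i.
  by rewrite Ee codomE (nth_map i) ?nth_ord_enum // size_enum_ord.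
have [_ _ Mhom] := Mb.
suff main k (kn : k = n) : exists b : 'I_k -> {mpoly R[n]} -> {mpoly R[n]},
    is_derivation_basis (root_arrangement J) b /\
    forall i : 'I_k, has_poly_degree (b i) (nth 0%N E i).
  exact: main.
subst k; exists (fun i => derivation_of (row i M)); split=> // i a.
rewrite derivation_of_linear_form nthE; apply: rpred_sum => j _.
apply: rpredZ; rewrite mxE; exact: Mhom.
Qed.

End DerivationModule.

(** * Heights *)

Section Heights.

Local Notation roots := Defs.roots.
Local Notation height := Defs.height.
Variables (R : realType) (n : nat) (Phi : root_system R n) (D : n.-tuple 'rV[R]_n).
Implicit Types (a b : 'rV[R]_n).
Hypothesis D_base : is_base Phi D.

(** Positive systems are cut out by vectors; this one represents the height. *)
Definition height_vec : 'cV[R]_n := \col_i height D (delta_mx 0 i).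

Lemma heightE a : height D a = pairing a height_vec.
Proof.
rewrite {1}[a]row_sum_delta /height /pairing mxE.
under eq_bigr do rewrite linear_sum.
rewrite exchange_big /=; apply: eq_bigr => j _; rewrite /height_vec mxE mulr_sumr.
by apply: eq_bigr => i _; rewrite linearZ.
Qed.

Let span_D a : a = \sum_i coord D i a *: D`_i.
Proof. by apply: coord_basis (memvf a); case: D_base. Qed.

Lemma height_simple (i : 'I_n) : height D D`_i = 1.
Proof.
have [/basis_free Dfree _ _] := D_base.
rewrite /height (bigD1 i) //= coord_free // eqxx big1 ?addr0 // => j ji.
by rewrite coord_free // eq_sym (negbTE ji).
Qed.

Lemma height_sum_eq0 a (s : R) : (s = 1 \/ s = -1) ->
  (forall i, s * coord D i a \is a Num.nat) -> s * height D a = 0 -> a = 0.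
Proof.
move=> s1 sa; rewrite /height mulr_sumr => /psumr_eq0P s0.
rewrite [a]span_D big1 // => i _.
have : s * coord D i a = 0 by apply: s0 => // j _; rewrite natr_ge0.
move/eqP; rewrite mulf_eq0 => /orP[/eqP s_0|/eqP->]; last by rewrite scale0r.
by case: s1; rewrite s_0 => /eqP; rewrite eq_sym ?oppr_eq0 oner_eq0.
Qed.

Lemma height_neq0 a : a \in roots Phi -> pairing a height_vec != 0.
Proof.
move=> aPhi; rewrite -heightE; apply: contraNneq (root_nz aPhi) => h0; apply/eqP.
have [_ _ /(_ a aPhi)[pos|neg]] := D_base.
  by apply: (@height_sum_eq0 _ 1); rewrite ?mul1r; [left|move=> i; rewrite mul1r|].
apply: (@height_sum_eq0 _ (-1)); rewrite ?mulN1r ?h0 ?oppr0 //; first by right.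
by move=> i; rewrite mulN1r.
Qed.

Lemma pos_rootsE : pos_roots Phi D = positive Phi predT height_vec.
Proof.
apply/fsetP => a; rewrite mem_fsep.
apply/andP/positiveP => [[aPhi /forallP a0]|[aPhi _ a0]].
  split=> //; rewrite lt_def height_neq0 // -heightE.
  by apply: sumr_ge0 => i _.
split=> //; apply/forallP => i; have [_ _ /(_ a aPhi)[pos|neg]] := D_base.
  exact: natr_ge0.
move: a0; rewrite -heightE ltNge; case/negP; rewrite -oppr_ge0 -sumrN.
by apply: sumr_ge0 => j _; exact: natr_ge0.
Qed.

Lemma height_positive a : a \in positive Phi predT height_vec ->
  exists k : nat, pairing a height_vec = k.+1%:R.
Proof.
rewrite -pos_rootsE mem_fsep -heightE => /andP[aPhi /forallP a0].
have : height D a \is a Num.nat.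
  apply: rpred_sum => i _; have [_ _ /(_ a aPhi)[//|/(_ i) neg]] := D_base.
  have := natr_ge0 neg; rewrite oppr_ge0 => a0'.
  have -> : coord D i a = 0 by apply/le_anti; rewrite a0' a0.
  exact: rpred0.
move=> /natrP[[|k] kE]; last by exists k.
by have := height_neq0 aPhi; rewrite -heightE kE eqxx.
Qed.

Lemma simple_indecomposable (i : 'I_n) : indecomposable Phi predT height_vec D`_i.
Proof.
have [_ sub _] := D_base; split.
  apply/positiveP; rewrite -heightE height_simple ltr01; split=> //.
  by apply: sub; rewrite mem_nth ?size_tuple.
move=> a b /height_positive[k kE] /height_positive[l lE] abE.
have := height_simple i; rewrite heightE abE pairingDl kE lE -natrD => /eqP.
by rewrite pnatr_eq1; lia.
Qed.

Lemma pairing_rho_height a :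
  pairing a (rho Phi predT height_vec) = 2 * pairing a height_vec.
Proof.
rewrite [a]span_D !pairing_suml mulr_sumr; apply: eq_bigr => i _.
rewrite !pairingZl -heightE height_simple pairing_rho //; first by ring.
  by move=> b bPhi _; exact: height_neq0.
exact: simple_indecomposable.
Qed.

End Heights.

(** * Dual partitions *)

Section DualPartition.

Lemma perm_eq_count_geq (s1 s2 : seq nat) :
  (forall t, count (leq t) s1 = count (leq t) s2) -> perm_eq s1 s2.
Proof.
move=> s12; have countE (s : seq nat) x :
    (count_mem x s + count (leq x.+1) s = count (leq x) s)%N.
  elim: s => //= y s <-; rewrite addnACA; congr addn.
  by rewrite (leq_eqVlt x y) eq_sym; case: ltngtP.
apply/allP => x _ /=.
by rewrite -(eqn_add2r (count (leq x.+1) s1)) countE !s12 countE.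
Qed.

Variables (lam : nat -> nat) (N : nat).
Hypothesis lam_anti : forall s t, (0 < s <= t)%N -> (lam t <= lam s)%N.
Hypothesis lam_out : forall t, (N < t)%N -> lam t = 0%N.

Lemma leq_count_antitone (v t : nat) : (0 < v)%N -> (0 < t)%N ->
  (t <= count (fun j => v <= lam j) (iota 1 N))%N = (v <= lam t)%N.
Proof.
move=> v0 t0; have [tN|Nt] := leqP t N; last first.
  rewrite lam_out // [RHS]leqNgt v0; apply/negbTE; rewrite -ltnNge.
  by apply: leq_ltn_trans (count_size _ _) _; rewrite size_iota.
have -> : N = (t.-1 + (N - t).+1)%N by lia.
rewrite iotaD count_cat add1n prednK //=.
have [vt|tv] := leqP v (lam t).
  have : all (fun j => v <= lam j)%N (iota 1 t.-1).
    apply/allP => j; rewrite mem_iota => jt; apply: leq_trans vt (lam_anti _); lia.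
  rewrite all_count size_iota => /eqP->; lia.
have -> : count (fun j => v <= lam j)%N (iota t.+1 (N - t)) = 0%N.
  apply/eqP; rewrite -leqn0 leqNgt -has_count.
  apply/hasPn => j; rewrite mem_iota => jt.
  by rewrite -ltnNge; apply: leq_ltn_trans tv; apply: lam_anti; lia.
have := count_size (fun j => v <= lam j)%N (iota 1 t.-1); rewrite size_iota; lia.
Qed.

Lemma count_reversed_leq (k l : nat) : (l <= k)%N ->
  count (fun i => k - i + 1 <= l)%N (iota 1 k) = l.
Proof.
move=> lk; rewrite -{2}(subnK lk) iotaD count_cat.
have -> : count (fun i => k - i + 1 <= l)%N (iota 1 (k - l)) = 0%N.
  apply/eqP; rewrite -leqn0 leqNgt -has_count.
  apply/hasPn => j; rewrite mem_iota; lia.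
have : all (fun i => k - i + 1 <= l)%N (iota (1 + (k - l)) l).
  by apply/allP => j; rewrite mem_iota; lia.
by rewrite all_count size_iota => /eqP->.
Qed.

(** The list consists of the parts of the dual partition, in the order of the
    ideal exponents; dualising twice gives back the partition. *)
Lemma count_dual_partition (t : nat) : (0 < t)%N ->
  count (leq t) [seq count (fun j => lam 1 - i + 1 <= lam j) (iota 1 N)
                   | i <- iota 1 (lam 1)]%N
  = lam t.
Proof.
move=> t0; rewrite count_map -[RHS](@count_reversed_leq (lam 1)); last first.
  by apply: lam_anti.
by apply: eq_count => i /=; rewrite leq_count_antitone // addn1.
Qed.

End DualPartition.

(** * Ideal arrangements *)

(** A real vector space is not a finite union of proper subspaces. *)
Lemma generic_vector (R : realType) (n k : nat) (B : 'M[R]_(k, n))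
    (s : seq 'rV[R]_n) :
  {in s, forall a, exists2 x, B *m x = 0 & pairing a x != 0} ->
  exists2 x, B *m x = 0 & {in s, forall a, pairing a x != 0}.
Proof.
elim: s => [_|a s IH sB]; first by exists 0; rewrite ?mulmx0.
have [|x Bx xs] := IH; first by move=> b bs; apply: sB; rewrite inE bs orbT.
have [y By ya] := sB a (mem_head _ _).
(* [t] only has to avoid the parameters where the line [x + t y] meets one of
   the hyperplanes; among [size (a :: s) + 1] values one is suitable *)
pose bad : seq R := [seq - pairing b x / pairing b y | b <- a :: s].
have [m mbad] : exists m : nat, m%:R \notin bad.
  apply: contrapT => nex.
  have sub : {subset [seq (m%:R : R) | m <- iota 0 (size bad).+1] <= bad}.
    by move=> _ /mapP[m _ ->]; apply/negPn/negP => mb; apply: nex; exists m.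
  have /uniq_leq_size/(_ sub) : uniq [seq (m%:R : R) | m <- iota 0 (size bad).+1].
    rewrite map_inj_uniq ?iota_uniq // => m1 m2 /eqP.
    by rewrite eqr_nat => /eqP.
  by rewrite size_map size_iota ltnn.
exists (x + m%:R *: y); first by rewrite mulmxDr -scalemxAr Bx By scaler0 addr0.
move=> b bs; rewrite pairingDr pairingZr; have [by0|by0] := eqVneq (pairing b y) 0.
  rewrite by0 mulr0 addr0; apply: xs; move: bs by0; rewrite inE.
  by case/orP => [/eqP->|//]; move/eqP; rewrite (negbTE ya).
apply: contra mbad; rewrite addrC addr_eq0 => /eqP mE; apply/mapP; exists b => //.
by rewrite -mE mulfK.
Qed.

Section IdealArrangement.

Local Notation roots := Defs.roots.
Local Notation height := Defs.height.
Variables (R : realType) (n : nat) (Phi : root_system R n) (D : n.-tuple 'rV[R]_n).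
Hypothesis D_base : is_base Phi D.
Local Notation h := (height_vec D).
Local Notation all_pos := (positive Phi predT h).
Variable J : {fset 'rV[R]_n}.
Hypothesis J_pos : J `<=` all_pos.
Hypothesis J_down : down_closed all_pos J.

Let h_reg a : a \in roots Phi -> pairing a h != 0.
Proof. exact: height_neq0. Qed.

Lemma nonproportional_sub (K : {fset 'rV[R]_n}) : K `<=` J -> nonproportional K.
Proof.
move=> KJ; have Kpos a : a \in K -> a \in all_pos.
  by move=> aK; exact/(fsubsetP J_pos)/(fsubsetP KJ).
split=> [a /Kpos/positiveP[aPhi _ _]|a b /Kpos apos /Kpos bpos k abk].
  exact: root_nz aPhi.
by rewrite abk (positive_double bpos apos abk) scale1r.
Qed.

Definition up_to (m : nat) := [fset a in J | pairing a h <= m%:R].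

Lemma J_height a : a \in J -> exists k : nat, pairing a h = k.+1%:R.
Proof. by move=> aJ; apply: (height_positive D_base); exact: (fsubsetP J_pos). Qed.

Lemma level_polynomial (m : nat) b : b \in J -> pairing b h = m.+1%:R ->
  exists B : {mpoly R[n]}, [/\ B != 0, B \is m.-homog
    & forall p, log_derivation (up_to m) p ->
        in_principal_ideal B (restrict b (act p b))].
Proof.
move=> bJ bm; have bpos := fsubsetP J_pos b bJ; have /positiveP[bPhi _ _] := bpos.
have upJ : up_to m `<=` J by apply/fsubsetP => a; rewrite mem_fsep => /andP[].
have [|||B [B0 Bhom Bdvd]] := @restriction_polynomial R n (up_to m) b.
- exact: root_nz bPhi.
- move=> a; rewrite mem_fsep => /andP[aJ am] c; apply: contraTneq am => aE.
  have c1 := positive_double bpos (fsubsetP J_pos a aJ) aE.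
  by rewrite aE c1 scale1r bm ler_nat ltnn.
- by have [_] := nonproportional_sub upJ.
exists B; split=> //; move: Bhom; congr (_ \is _.-homog).
have upE : up_to m = [fset a in J | pairing a h < pairing b h].
  apply/fsetP => a; rewrite !mem_fsep; have [aJ|//] := boolP (a \in J).
  by have [k ->] := J_height aJ; rewrite bm ler_nat ltr_nat.
rewrite upE; apply: (restriction_count h_reg J_pos J_down bJ).
by rewrite pairing_rho_height // bm.
Qed.

Definition level (m : nat) := [fset a in J | height D a == m%:R].

Lemma levelP m a : reflect (a \in J /\ pairing a h = m%:R) (a \in level m).
Proof. by rewrite mem_fsep (heightE D); apply: (iffP andP) => -[? /eqP]. Qed.

(** The roots of height [m + 1] are added all at once by [multiple_addition].
    Such a step raises by one the [lambda_(m + 1)] basis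
    elements of maximal degree [m], so that at the end the number of degrees
    that are at least [t] is [lambda_t]. *)
Theorem ideal_graded_basis (m : nat) :
  exists M e, [/\ graded_basis (up_to m) M e, forall i, (e i <= m)%N &
    forall t, (0 < t <= m)%N -> #|[pred i | t <= e i]%N| = lambda D J t].
Proof.
elim: m => [|m [M [e [Mb em eC]]]].
  exists 1%:M, (fun=> 0%N); split=> // [|t]; last by case: t.
  suff -> : up_to 0 = fset0 by exact: graded_basis0.
  apply/fsetP => a; rewrite mem_fsep inE; apply/negP => /andP[/J_height[k ->]].
  by rewrite ler_nat.
pose L := enum_fset (level m.+1); pose q := size L.
pose B : 'M[R]_(q, n) := \matrix_(j < q) L`_j.
have rowB j : row j B = L`_j by rewrite rowK.
have LP (j : 'I_q) : L`_j \in J /\ pairing L`_j h = m.+1%:R.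
  by apply/levelP; apply: mem_nth.
have LPhi (j : 'I_q) : L`_j \in roots Phi.
  by have [/(fsubsetP J_pos)/positiveP[]] := LP j.
have Bfree : row_free B.
  apply: inj_row_free => v; rewrite mulmx_sum_row => v0; apply/rowP => j.
  rewrite mxE; move: j.
  apply: (@obtuse_independent _ _ Phi _ (fun j => row j B) h) => // [i j ij|j].
    rewrite !rowB.
    apply: (@same_level_obtuse _ _ _ fullv h) => //; rewrite ?memvf //.
    - by move=> a aPhi _; exact: h_reg.
    - by rewrite nth_uniq ?fset_uniq.
    - by rewrite (LP i).2 (LP j).2.
  by rewrite rowB (LP j).2 ltr0n.
have /choice[b bP] j := level_polynomial (LP j).1 (LP j).2.
(* otherwise a root of height at most [m] would lie in the span of roots of
   height [m + 1], against [level_gap] *)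
have [x Bx xJ] : exists2 x, B *m x = 0 & {in up_to m, forall a, pairing a x != 0}.
  apply: generic_vector => a; rewrite mem_fsep => /andP[aJ am].
  apply: contrapT => nex; have /submxP[u aE] : (a <= B)%MS.
    rewrite submxE; apply/eqP/rowP => j; rewrite [RHS]mxE; apply: contrapT => aj.
    apply: nex; exists (col j (cokermx B)).
      by rewrite colE mulmxA mulmx_coker mul0mx.
    by apply/eqP; rewrite /pairing colE mulmxA -colE mxE.
  have aL : a \in <<level m.+1>>%VS.
    rewrite aE mulmx_sum_row; apply: rpred_sum => j _; rewrite rowB.
    exact/rpredZ/memv_span/mem_nth.
  have /positiveP[aPhi _ a0] := fsubsetP J_pos a aJ.
  suff : m.+1%:R <= pairing a h.
    by rewrite leNgt => /negP; apply; rewrite (le_lt_trans am) ?ltr_nat.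
  apply: (@level_gap _ _ Phi h (level m.+1)) => //.
    by move=> c /levelP[/(fsubsetP J_pos)/positiveP[cPhi _ _] ->].
  by move=> c cPhi _; exact: h_reg.
have [|||||M' [f [f_inj ef M'b]]] :=
  @multiple_addition R n (up_to m) M e m q B b x Mb em Bfree.
- by move=> j; case: (bP j).
- by move=> j; case: (bP j).
- by move=> j p; rewrite rowB; case: (bP j) => _ _; exact.
- by move=> j; rewrite /pairing -row_mul Bx row0 mxE.
- exact: xJ.
exists M', (fun i => e i + (i \in codom f))%N; split.
- move: M'b; congr graded_basis; apply/fsetP => a; rewrite in_fsetU !mem_fsep.
  apply/orP/andP => [[/andP[aJ am]|/imfsetP[j _ ->]]|[aJ am]].
  + by split=> //; apply: le_trans am _; rewrite ler_nat.
  + by rewrite rowB (LP j).1 (LP j).2 lexx.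
  have [k kE] := J_height aJ; rewrite kE ler_nat in am; rewrite aJ kE ler_nat.
  have [km|mk] := leqP k.+1 m; [by left|right].
  have aL : a \in level m.+1 by apply/levelP; rewrite kE; have -> : k = m by lia.
  have iL : (index a L < q)%N by rewrite index_mem.
  by apply/imfsetP; exists (Ordinal iL); rewrite // rowB /= nth_index.
- move=> i; have := em i; case: (i \in codom f); lia.
move=> t /andP[t0]; rewrite leq_eqVlt => /orP[/eqP->|tm].
  rewrite /lambda -/(level m.+1) -/L -[RHS](card_ord q) -(card_codom f_inj).
  apply: eq_card => i; rewrite inE /=; have := em i.
  by have [/codomP[j ->]|_] := boolP (i \in codom f); rewrite ?ef; lia.
rewrite -eC ?t0 //; apply: eq_card => i; rewrite !inE /=.
by have [/codomP[j ->]|_] := boolP (i \in codom f); rewrite ?ef; lia.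
Qed.

Theorem ideal_arrangement_exponents :
  let k := lambda D J 1 in
  is_free (root_arrangement J) /\
  exists e : seq nat,
    [/\ has_exponents (root_arrangement J) e,
        perm_eq [seq d <- e | d != 0%N]
                [seq ideal_exponent D J i | i <- iota 1 k]
      & count_mem 0%N e = (n - k)%N].
Proof.
move=> k; set N := max_height D J.
have J_le a l : a \in J -> pairing a h = l%:R -> (l <= N)%N.
  move=> aJ al; rewrite /N /max_height (big_rem a) //= (heightE D) al.
  by rewrite natrK leq_maxl.
have upN : up_to N = J.
  apply/fsetP => a; rewrite mem_fsep; have [aJ|//] := boolP (a \in J).
  by have [l lE] := J_height aJ; rewrite lE ler_nat (J_le _ _ aJ lE).
have [M [e [Mb eN eC]]] := ideal_graded_basis N; rewrite upN in Mb.
have Jnp := nonproportional_sub (fsubset_refl J).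
have [free_J exp_J] := graded_basis_free_exponents Jnp Mb erefl.
split=> //; exists (codom e).
have lam_out t : (N < t)%N -> lambda D J t = 0%N.
  move=> Nt; apply/eqP; rewrite cardfs_eq0; apply/eqP/fsetP => a; rewrite [RHS]inE.
  by apply/negP => /levelP[aJ at_]; have := J_le _ _ aJ at_; lia.
have countE t : (0 < t)%N -> count (leq t) (codom e) = lambda D J t.
  move=> t0; have -> : count (leq t) (codom e) = #|[pred i | t <= e i]%N|.
    rewrite /codom /image_mem count_map cardE /enum_mem size_filter.
    by rewrite count_filter; apply: eq_count => i; rewrite /= inE andbT.
  have [tN|Nt] := leqP t N; first by rewrite eC ?t0.
  rewrite lam_out //; apply: eq_card0 => i; rewrite inE /=; apply/negbTE.
  by rewrite -ltnNge; apply: leq_ltn_trans (eN i) Nt.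
have lam_anti s t : (0 < s <= t)%N -> (lambda D J t <= lambda D J s)%N.
  move=> /andP[s0 st]; rewrite -!countE ?(leq_trans s0) //.
  by apply: sub_count => d; exact: leq_trans.
have dualE := count_dual_partition lam_anti lam_out.
split=> //; last first.
  have := countE 1%N isT; rewrite -/k => <-.
  rewrite -[n in (n - _)%N](card_ord n) -(size_codom e).
  rewrite -(count_predC (leq 1)) addKn.
  by apply: eq_count => d /=; rewrite -leqNgt leqn0.
apply: perm_eq_count_geq => -[|t]; last first.
  rewrite dualE // -countE // count_filter; apply: eq_count => d /=.
  by rewrite andb_idr //; case: d.
have all0 (s : seq nat) : count (leq 0) s = size s by exact: count_predT.
rewrite !all0 size_map size_iota size_filter -[k](countE 1%N) //.
by apply: eq_count => -[].
Qed.

End IdealArrangement.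

Theorem theorem11p1 (R : realType) (n : nat)
    (Phi : root_system R n) (D : n.-tuple 'rV[R]_n)
    (Phi_irr : irreducible_roots Phi) (D_base : is_base Phi D)
    (not_F4 : ~ has_cartan_matrix Phi D 4 cartan_F4)
    (not_E6 : ~ has_cartan_matrix Phi D 6 cartan_E)
    (not_E7 : ~ has_cartan_matrix Phi D 7 cartan_E)
    (not_E8 : ~ has_cartan_matrix Phi D 8 cartan_E)
    (I : {fset 'rV[R]_n}) (I_ideal : is_ideal Phi D I) :
  let Ic := pos_roots Phi D `\` I in
  let k := lambda D Ic 1 in
  let A := root_arrangement Ic in
  is_free A /\
  exists e : seq nat,
    [/\ has_exponents A e,
        perm_eq [seq d <- e | d != 0%N]
                [seq ideal_exponent D Ic i | i <- iota 1 k]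
      & count_mem 0%N e = (n - k)%N].
Proof.
move=> Ic k A; have [_ I_up] := I_ideal.
have posE := pos_rootsE D_base.
apply: (ideal_arrangement_exponents D_base); rewrite -posE.
  exact: fsubsetDl.
move=> a b apos bpos; rewrite !in_fsetD apos andbT => /andP[abI abpos].
by apply: contra abI => aI; exact: I_up.
Qed.
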